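(* Let $n\ge 1$ be an integer and $\sigma>0$. Let $f:\mathbb{R}^n\to\mathbb{C}$ be the characteristic function of a continuous probability density $\varphi$ on $\mathbb{R}^n$. Suppose that there exists $\delta>0$ such that $$\{t\in\mathbb{R}^n: |\varphi(t)|>0\}=\Bigl\{x\in\mathbb{R}^n:\ \sum_{k=1}^n|x_k|^2<\delta^2\Bigr\}.$$ If $$\delta\sigma>\pi\sqrt{n},$$ then $f$ does not have the $\sigma$-deterministic property.
   Context: For a probability (Borel) measure $\mu$ on $\mathbb{R}^n$, its characteristic function is $\hat\mu(x)=\int_{\mathbb{R}^n}e^{-i(x,t)}\,d\mu(t)$, $x\in\mathbb{R}^n$, where $(x,t)=\sum_{k=1}^n x_kt_k$. A function on $\mathbb{R}^n$ is called a characteristic function if it is the characteristic function of some probability measure on $\mathbb{R}^n$. A probability density is a function $\varphi\in L^1(\mathbb{R}^n)$ with $\varphi\ge 0$ and $\|\varphi\|_{L^1(\mathbb{R}^n)}=1$; its characteristic function is that of the measure $\varphi\,dt$. For $\sigma>0$ set $Q^n_\sigma=\{x\in\mathbb{R}^n: |x_k|\le\sigma,\ k=1,\dots,n\}$ and $V_\sigma=\mathbb{R}^n\setminus Q^n_\sigma$. A characteristic function $f$ on $\mathbb{R}^n$ has the $\sigma$-deterministic property if there is no characteristic function $g$ on $\mathbb{R}^n$ with $g\not\equiv f$ such that $f(x)=g(x)$ for all $x\in V_\sigma$. *)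

(* Defs.v *)
From HB Require Import structures.
From mathcomp Require Import all_boot all_order all_algebra.
From mathcomp Require Import all_classical all_reals all_analysis.
From mathcomp Require Import measurable_realfun.
From mathcomp.real_closed Require Import complex.

Set Implicit Arguments.
Unset Strict Implicit.
Unset Printing Implicit Defensive.

Import Order.TTheory GRing.Theory Num.Theory.
Import numFieldNormedType.Exports.

Local Open Scope classical_set_scope.
Local Open Scope ring_scope.

Definition borel_rV_display : measure_display.
Proof. exact. Qed.

Section borel_rV.
Context {R : realType} {n : nat}.

Let borel_rV : set_system 'rV[R]_n := <<s [set A | open A] >>.

Let borel_rV0 : borel_rV set0.
Proof. exact: sigma_algebra0. Qed.

Let borel_rVC A : borel_rV A -> borel_rV (~` A).
Proof. exact: sigma_algebraC. Qed.

Let borel_rV_bigcup (F : (set 'rV[R]_n)^nat) :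
  (forall i, borel_rV (F i)) -> borel_rV (\bigcup_i (F i)).
Proof. exact: sigma_algebra_bigcup. Qed.

HB.instance Definition _ := @isMeasurable.Build borel_rV_display
  'rV[R]_n borel_rV borel_rV0 borel_rVC borel_rV_bigcup.

Lemma open_measurable_rV (U : set 'rV[R]_n) : open U -> measurable U.
Proof. exact: sub_gen_smallest. Qed.

Lemma continuous_measurable_rV (h : 'rV[R]_n -> R) :
  continuous h -> measurable_fun setT h.
Proof.
move=> /continuousP ch; apply: (measurability _ (RGenOpens.measurableE R)).
move=> _ [_ [a [b ->]] <-]; rewrite setTI; apply: open_measurable_rV.
by apply: ch; exact: interval_open.
Qed.

Lemma measurable_fun_coord (j : 'I_n) :
  measurable_fun setT (fun v : 'rV[R]_n => v ord0 j).
Proof. by apply: continuous_measurable_rV => v; exact: coord_continuous. Qed.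

Lemma open_bigcup_rat_ball (U : set 'rV[R]_n) : open U ->
  U = \bigcup_(p : 'rV[rat]_n * nat)
        [set x : 'rV[R]_n | ball (map_mx ratr p.1 : 'rV[R]_n) p.2.+1%:R^-1 `<=` U /\
                 forall j, ball (ratr (p.1 ord0 j) : R) p.2.+1%:R^-1
                                (x ord0 j)].
Proof.
move=> oU; apply/seteqP; split => x /=.
  move=> Ux; have /nbhs_ballP[e /= e0 xeU] : nbhs x U by exact: open_nbhs_nbhs.
  have [k] : exists k, 0 + k.+1%:R^-1 < e / 2.
    by apply: ltr_add_invr; rewrite divr_gt0.
  rewrite add0r => ke; have k0 : 0 < k.+1%:R^-1 :> R by rewrite invr_gt0.
  have /choice[q xq] j : exists q : rat,
      ball (ratr q : R) k.+1%:R^-1 (x ord0 j).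
    have /rat_in_itvoo[q] : x ord0 j < x ord0 j + k.+1%:R^-1 by rewrite ltrDl.
    rewrite in_itv/= => /andP[xq qx]; exists q.
    by rewrite /ball/= gtr0_norm ?subr_gt0// ltrBlDr addrC.
  exists (\row_j q j, k) => //=; split; last by move=> j; rewrite mxE.
  move=> y [_ qy]; apply: xeU; split => // i j.
  rewrite ord1 (splitr e).
  apply: (@ball_triangle R R (ratr (q j) : R)).
    by apply: ball_sym; apply: le_ball (xq j); exact: ltW.
  by apply: le_ball (ltW ke) _ _; have := qy ord0 j; rewrite !mxE.
move=> [[q k] _ /= [qU qx]]; apply: qU; split; first by rewrite invr_gt0.
by move=> i j; rewrite ord1 !mxE; exact: qx.
Qed.

Lemma measurable_fun_rV d (T : measurableType d) (f : T -> 'rV[R]_n) :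
  (forall j, measurable_fun setT (fun x => f x ord0 j)) ->
  measurable_fun setT f.
Proof.
move=> mf; refine (@measurability _ _ _ _ _ _ [set A : set 'rV[R]_n | open A] erefl _).
move=> _ [U oU <-].
rewrite setTI (open_bigcup_rat_ball oU) preimage_bigcup.
apply: countable_bigcupT_measurable => // -[q k] /=.
have [qU|qU] := pselect (ball (map_mx ratr q : 'rV[R]_n) k.+1%:R^-1 `<=` U).
  rewrite (_ : _ @^-1` _ = \bigcap_(j in [set: 'I_n])
      ((fun x => f x ord0 j) @^-1` ball (ratr (q ord0 j) : R) k.+1%:R^-1)).
    apply: fin_bigcap_measurable => // j _; rewrite -[X in measurable X]setTI.
    by apply: mf => //; exact: measurable_ball.
  apply/seteqP; split => x /=; first by move=> [_ fx] j _; exact: fx.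
  by move=> fx; split => // j; exact: fx.
by rewrite (_ : _ @^-1` _ = set0)//; apply/seteqP; split => // x [].
Qed.

End borel_rV.

Section lebesgue_rV.
Context {R : realType}.

Definition cons_rV n (p : R * 'rV[R]_n) : 'rV[R]_n.+1 :=
  row_mx (p.1%:M : 'M[R]_1) p.2.

Definition uncons_rV n (v : 'rV[R]_n.+1) : R * 'rV[R]_n :=
  (v ord0 ord0, \row_j v ord0 (lift ord0 j)).

Lemma cons_rV0 n (p : R * 'rV[R]_n) : cons_rV p ord0 ord0 = p.1.
Proof.
rewrite (_ : ord0 = lshift n ord0 :> 'I_(1 + n)); last exact/val_inj.
by rewrite [LHS]row_mxEl mxE eqxx.
Qed.

Lemma cons_rVS n (p : R * 'rV[R]_n) j :
  cons_rV p ord0 (lift ord0 j) = p.2 ord0 j.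
Proof.
rewrite (_ : lift ord0 j = rshift 1 j); last exact/val_inj.
by rewrite [LHS]row_mxEr.
Qed.

Lemma cons_rVK n : cancel (@cons_rV n) (@uncons_rV n).
Proof.
move=> p; rewrite /uncons_rV cons_rV0; case: p => x v /=; congr pair.
by apply/rowP => j; rewrite mxE cons_rVS.
Qed.

Lemma measurable_cons_rV n : measurable_fun setT (@cons_rV n).
Proof.
apply: measurable_fun_rV => j; have [i ->|->] := unliftP ord0 j.
  under eq_fun do rewrite cons_rVS.
  exact: measurableT_comp (measurable_fun_coord i) measurable_snd.
by under eq_fun do rewrite cons_rV0; exact: measurable_fst.
Qed.

HB.instance Definition _ n :=
  isMeasurableFun.Build _ _ _ _ (@cons_rV n) (@measurable_cons_rV n).

Lemma measurable_uncons_rV n : measurable_fun setT (@uncons_rV n).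
Proof.
apply/measurable_fun_pairP; split; first exact: measurable_fun_coord.
apply: measurable_fun_rV => j.
under eq_fun do rewrite /= mxE.
exact: measurable_fun_coord.
Qed.

Definition lebesgue_cons n (m : {sigma_finite_measure set 'rV[R]_n -> \bar R}) :=
  pushforward (@lebesgue_measure R \x m)%E (@cons_rV n).

Section lebesgue_cons.
Variables (n : nat) (m : {sigma_finite_measure set 'rV[R]_n -> \bar R}).

Let lebesgue_cons0 : lebesgue_cons m set0 = 0%E.
Proof. by rewrite /lebesgue_cons /pushforward preimage_set0 measure0. Qed.

Let lebesgue_cons_ge0 A : (0 <= lebesgue_cons m A)%E.
Proof. by rewrite /lebesgue_cons /pushforward measure_ge0. Qed.

Let lebesgue_cons_sigma_additive : semi_sigma_additive (lebesgue_cons m).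
Proof.
rewrite /lebesgue_cons; apply: measure_semi_sigma_additive; exact: measurable_cons_rV.
Qed.

HB.instance Definition _ := isMeasure.Build _ _ _ (lebesgue_cons m)
  lebesgue_cons0 lebesgue_cons_ge0 lebesgue_cons_sigma_additive.

Let sigma_finite_lebesgue_cons : sigma_finite setT (lebesgue_cons m).
Proof.
have /sigma_finiteP[F [FT ndF Foo]] := sigma_finiteT (@lebesgue_measure R).
have /sigma_finiteP[G [GT ndG Goo]] := sigma_finiteT m.
exists (fun k => @uncons_rV n @^-1` (F k `*` G k)).
  apply/esym; rewrite -subTset => v _.
  have [i _ Fi] : (\bigcup_k F k) (uncons_rV v).1 by rewrite -FT.
  have [j _ Gj] : (\bigcup_k G k) (uncons_rV v).2 by rewrite -GT.
  exists (maxn i j) => //; split.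
    by move: Fi; exact/subsetPset/ndF/leq_maxl.
  by move: Gj; exact/subsetPset/ndG/leq_maxr.
move=> k; have [mF Fk] := Foo k; have [mG Gk] := Goo k.
have mFG : measurable (F k `*` G k) by exact: measurableX.
split.
  by rewrite -[X in measurable X]setTI; exact: measurable_uncons_rV.
rewrite /lebesgue_cons /pushforward -comp_preimage (_ : _ \o _ = id).
  by rewrite preimage_id product_measure1E// lte_mul_pinfty// ge0_fin_numE.
by apply/funext => p; exact: cons_rVK.
Qed.

HB.instance Definition _ := Measure_isSigmaFinite.Build _ _ _
  (lebesgue_cons m) sigma_finite_lebesgue_cons.
End lebesgue_cons.

(* n-dimensional Lebesgue measure as an iterated product of the one-dimensional
   one (see lebesgue_rV_box); for n = 0 it is the unit mass at the only point. *)
Fixpoint lebesgue_rV n : {sigma_finite_measure set 'rV[R]_n -> \bar R} :=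
  match n with
  | 0 => \d_(0 : 'rV[R]_0)
  | n'.+1 => lebesgue_cons (lebesgue_rV n')
  end.

Lemma lebesgue_rV_box n (A : 'I_n -> set R) : (forall j, measurable (A j)) ->
  lebesgue_rV n [set v : 'rV[R]_n | forall j, A j (v ord0 j)] =
  (\prod_(j < n) lebesgue_measure (A j))%E.
Proof.
elim: n A => [|n ih] A mA.
  by rewrite big_ord0 /= diracE mem_set// => -[].
have mB : measurable [set v : 'rV[R]_n | forall j, A (lift ord0 j) (v ord0 j)].
  rewrite (_ : [set _ | _] = \bigcap_(j in [set: 'I_n])
      ((fun v : 'rV[R]_n => v ord0 j) @^-1` A (lift ord0 j))).
    apply: fin_bigcap_measurable => // j _; rewrite -[X in measurable X]setTI.
    exact: measurable_fun_coord.
  by apply/seteqP; split => v /= Av j; [move=> _|]; exact: Av.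
rewrite big_ord_recl -ih// -product_measure1E//=; last exact: mA.
congr product_measure1; apply/seteqP; split => p /=.
  by move=> Ap; split => [|j]; [rewrite -cons_rV0|rewrite -cons_rVS]; exact: Ap.
move=> [A0 AS] j; have [i ->|->] := unliftP ord0 j.
  by rewrite cons_rVS; exact: AS.
by rewrite cons_rV0.
Qed.

End lebesgue_rV.

Section characteristic_function.
Context {R : realType}.

(* e^{i s}, written out through Euler's formula *)
Definition expi (s : R) : R[i] := (cos s +i* sin s)%C.

(* Componentwise integral: for integrable f, the integral of Re f plus i times
   that of Im f; MathComp-Analysis only integrates real-valued functions. *)
Definition cintegral d (T : measurableType d) (mu : {measure set T -> \bar R})
    (f : T -> R[i]) : R[i] :=
  (\int[mu]_t complex.Re (f t) +i* \int[mu]_t complex.Im (f t))%C.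

Definition dotrV n (x t : 'rV[R]_n) : R := \sum_(k < n) x ord0 k * t ord0 k.

Definition char_fun n (mu : probability 'rV[R]_n R) (x : 'rV[R]_n) : R[i] :=
  cintegral mu (fun t => expi (- dotrV x t)).

Definition is_char_fun n (f : 'rV[R]_n -> R[i]) : Prop :=
  exists mu : probability 'rV[R]_n R, f = char_fun mu.

Definition probability_density n (phi : 'rV[R]_n -> R) : Prop :=
  [/\ (lebesgue_rV n).-integrable setT (EFin \o phi),
      forall t, 0 <= phi t &
      ('N[lebesgue_rV n]_1 [EFin \o phi] = 1)%E].

Definition has_density n (mu : probability 'rV[R]_n R) (phi : 'rV[R]_n -> R) :=
  forall A, measurable A -> mu A = (\int[lebesgue_rV n]_(t in A) (phi t)%:E)%E.

Definition is_char_fun_of_density n (phi : 'rV[R]_n -> R)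
    (f : 'rV[R]_n -> R[i]) : Prop :=
  exists2 mu : probability 'rV[R]_n R, has_density mu phi & f = char_fun mu.

Definition cube n (sigma : R) : set 'rV[R]_n :=
  [set x : 'rV[R]_n | forall k, `|x ord0 k| <= sigma].

(* g <> f is an inequality of functions, i.e. g is not identically f. *)
Definition deterministic n (sigma : R) (f : 'rV[R]_n -> R[i]) : Prop :=
  ~ exists g : 'rV[R]_n -> R[i],
      [/\ is_char_fun g, g <> f &
         forall x, (~` cube sigma) x -> f x = g x].

End characteristic_function.

(* Main.v *)
Require Import Defs.
From HB Require Import structures.
From mathcomp Require Import all_boot all_order all_algebra.
From mathcomp Require Import all_classical all_reals all_analysis.
From mathcomp.real_closed Require Import complex.
From mathcomp Require Import measurable_realfun ring lra.

Set Implicit Arguments.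
Unset Strict Implicit.
Unset Printing Implicit Defensive.

Import Order.TTheory GRing.Theory Num.Theory.
Import numFieldNormedType.Exports.

Local Open Scope classical_set_scope.
Local Open Scope ring_scope.

(** Let [a := pi / sigma].  It suffices to find a real integrable [H <> 0] on
    R^n, with total integral zero, whose Fourier transform vanishes off the cube
    of half-side [sigma], and which is nonnegative outside the closed ball of
    radius [a * sqrt n].  Indeed that radius is smaller than [delta], so the
    continuous density [phi] is bounded below by a positive constant on this
    ball; for small [eps > 0] the function [phi + eps * H] is then again a
    density ([perturbation_ge0]), and its characteristic function agrees with
    that of [phi] off the cube but is a different function.

    In one variable consider the nonnegative function
      [w t = (1 + cos (sigma * t)) / (t ^+ 2 - a ^+ 2) ^+ 2]
    ([window]) and [h t = (t ^+ 2 - a ^+ 2) * w t] ([swindow]).  Both are cosine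
    transforms of explicit functions carried by [`[0, sigma]]: [h] comes from a
    multiple of [sin (a * s)], which is half a period of a sine
    ([cos_transform_swindow_spec]), and [w] from [window_spec]
    ([cos_transform_window_spec]).  By inversion their own transforms vanish
    beyond [sigma], and that of [h] also vanishes at 0 because [sin] does.  Set
      [H v = (\sum_k v_k ^+ 2 - n * a ^+ 2) * \prod_k w (v_k)
           = \sum_k h (v_k) * \prod_(j != k) w (v_j)]
    ([witness], [witnessE]).  The first expression shows the sign of [H].  The
    second is a sum of tensor products, so that its transform is a sum of
    products of one-dimensional transforms ([tensor_transform]), each containing
    a factor that vanishes at frequencies outside the cube, and the factor of
    [h], which vanishes at 0.

    Only a vanishing part of Fourier inversion enters ([cos_transform_eq0]): if
    an even integrable [u] is almost everywhere the cosine transform of a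
    compactly supported [m], and [m] vanishes to first order at the frequencies
    [x] and [- x], then the transform of [u] is zero at [x].  It follows from
    the symmetry of the cosine transform ([cos_transform_mult], an instance of
    Fubini) applied to the kernels [(1 - t / N) * cos (x * t)] on [`[0, N]],
    whose transforms are explicit.  The same symmetry gives [H <> 0] at the
    level of transforms: were the transform of [h] identically zero, then so
    would be the integral of [h ^+ 2]. *)

(** * Integrability and product integrals *)

Section integrability.
Context d (T : measurableType d) (R : realType).
Variable mu : {measure set T -> \bar R}.
Implicit Types f g : T -> R.

Lemma integrable_measurable f :
  mu.-integrable setT (EFin \o f) -> measurable_fun setT f.
Proof. by move=> /measurable_int/measurable_EFinP. Qed.

Lemma le_integrable_real f g : measurable_fun setT f ->
  (forall t, `|f t| <= g t) ->
  mu.-integrable setT (EFin \o g) -> mu.-integrable setT (EFin \o f).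
Proof.
move=> mf fg ig; apply: (le_integrable measurableT _ _ ig).
  exact/measurable_EFinP.
by move=> t _ /=; rewrite lee_fin (le_trans (fg t))// ler_norm.
Qed.

Lemma integrable_mul_bounded f g M : mu.-integrable setT (EFin \o f) ->
  measurable_fun setT g -> (forall t, `|g t| <= M) ->
  mu.-integrable setT (EFin \o (fun t => f t * g t)).
Proof.
move=> intf mg gM.
have mf : measurable_fun setT f by exact: integrable_measurable intf.
have iM : mu.-integrable setT (EFin \o (fun t => `|f t| * M)).
  rewrite (_ : _ \o _ = (fun t => M%:E * (`|f t|)%:E)%E); last first.
    by apply/funext => t /=; rewrite -EFinM mulrC.
  by apply: integrableZl => //; exact: integrable_norm.
apply: le_integrable_real iM; first exact: measurable_funM.
by move=> t; rewrite normrM ler_wpM2l.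
Qed.

Lemma integrable_sum_fun (I : Type) (r : seq I) (u : I -> T -> R) :
  (forall i, mu.-integrable setT (EFin \o u i)) ->
  mu.-integrable setT (EFin \o (fun t => \sum_(i <- r) u i t)).
Proof.
move=> iu; elim: r => [|i r ih].
  rewrite (_ : _ \o _ = cst 0%E); first exact: integrable0.
  by apply/funext => t /=; rewrite big_nil.
rewrite (_ : _ \o _ = (EFin \o u i) \+ (EFin \o (fun t => \sum_(i <- r) u i t))).
  exact: integrableD.
by apply/funext => t /=; rewrite big_cons.
Qed.

Lemma Rintegral_sum (I : Type) (r : seq I) (u : I -> T -> R) :
  (forall i, mu.-integrable setT (EFin \o u i)) ->
  \int[mu]_t (\sum_(i <- r) u i t) = \sum_(i <- r) \int[mu]_t u i t.
Proof.
move=> iu; elim: r => [|i r ih].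
  under eq_Rintegral do rewrite big_nil.
  by rewrite big_nil Rintegral_cst// mul0r.
under eq_Rintegral do rewrite big_cons.
by rewrite RintegralD// ?ih ?big_cons//; exact: integrable_sum_fun.
Qed.

Lemma Rintegral_dominated_cvg (f_ : nat -> T -> R) (f g : T -> R) :
  (forall n, measurable_fun setT (f_ n)) -> measurable_fun setT f ->
  (forall t, f_ ^~ t @ \oo --> f t) ->
  mu.-integrable setT (EFin \o g) -> (forall n t, `|f_ n t| <= g t) ->
  \int[mu]_t f_ n t @[n --> \oo] --> \int[mu]_t f t.
Proof.
move=> mf_ mf f_f ig f_g.
have [|||||if_ _ cvf] := @dominated_convergence _ _ _ mu setT measurableT
  (fun n => EFin \o f_ n) (EFin \o f) (EFin \o g).
- by move=> n; exact/measurable_EFinP.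
- exact/measurable_EFinP.
- by apply: aeW => t _; apply: cvg_EFin; [exact: nearW|exact: f_f].
- exact: ig.
- by apply: aeW => t n _ /=; rewrite lee_fin.
apply: fine_cvg; rewrite /Rintegral fineK//; exact: integrable_fin_num.
Qed.

End integrability.

Section product_integral.
Context d1 d2 (T1 : measurableType d1) (T2 : measurableType d2) (R : realType).
Variables (m1 : {sigma_finite_measure set T1 -> \bar R})
          (m2 : {sigma_finite_measure set T2 -> \bar R}).
Variables (f : T1 -> R) (g : T2 -> R).
Hypotheses (intf : m1.-integrable setT (EFin \o f))
           (intg : m2.-integrable setT (EFin \o g)).

Lemma integrable_prod :
  (m1 \x m2)%E.-integrable setT (EFin \o (fun p : T1 * T2 => f p.1 * g p.2)).
Proof.
have mf : measurable_fun setT f := integrable_measurable intf.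
have mg : measurable_fun setT g := integrable_measurable intg.
apply/integrable12ltyP.
  apply/measurable_EFinP; apply: measurable_funM.
    exact: measurableT_comp mf measurable_fst.
  exact: measurableT_comp mg measurable_snd.
have /integrableP[_ fy] := intf; have /integrableP[_ gy] := intg.
rewrite (eq_integral (fun x => `|f x|%:E * \int[m2]_y `|g y|%:E)%E); last first.
  move=> x _; rewrite -ge0_integralZl//.
  - by apply: eq_integral => y _; rewrite /= normrM EFinM.
  - by apply/measurable_EFinP; exact: measurableT_comp.
rewrite ge0_integralZr//.
- apply: lte_mul_pinfty => //; first exact: integral_ge0.
  by rewrite ge0_fin_numE//; exact: integral_ge0.
- by apply/measurable_EFinP; exact: measurableT_comp.
- exact: integral_ge0.
Qed.

Lemma Rintegral_prod :
  \int[(m1 \x m2)%E]_p (f p.1 * g p.2) = \int[m1]_x f x * \int[m2]_y g y.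
Proof.
rewrite {1}/Rintegral -(integral12_prod_meas1 integrable_prod)/=.
rewrite (eq_integral (fun x => (f x)%:E * (\int[m2]_y g y)%:E)%E); last first.
  move=> x _; rewrite /fubini_F/=.
  under eq_integral do rewrite EFinM.
  rewrite integralZl//; congr (_ * _)%E.
  by rewrite /Rintegral fineK//; exact: integrable_fin_num.
by rewrite integralZr// fineM//=; exact: integrable_fin_num.
Qed.

End product_integral.

(** * Calculus and integration on the real line *)

Section derivatives.
Context {R : realType}.
Implicit Types (c s t y : R).

Lemma is_derive1_mulr (f : R -> R) s df c : is_derive s 1 f df ->
  is_derive s 1 (fun z => c * f z) (c * df).
Proof. by move=> h; exact: (is_deriveZ c h). Qed.

Lemma is_derive1_mul (f g : R -> R) s df dg :
  is_derive s 1 f df -> is_derive s 1 g dg ->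
  is_derive s 1 (fun z => f z * g z) (f s * dg + g s * df).
Proof. by move=> h1 h2; exact: (is_deriveM h1 h2). Qed.

Lemma is_derive1_mull (t s : R) : is_derive s 1 ( *%R t) t.
Proof.
have h : is_derive s 1 (fun x : R => cst t x * id x) _ :=
  is_deriveM (is_derive_cst t s 1) (is_derive_id s 1).
by apply: (is_derive_eq h); rewrite scaler0 addr0 /GRing.scale/= mulr1.
Qed.

Lemma is_derive1_subl c s : is_derive s 1 (fun s => c - s) (- 1).
Proof.
have h := is_deriveB (is_derive_cst c s 1) (is_derive_id s (1 : R)).
by apply: (is_derive_eq h); rewrite sub0r.
Qed.

Lemma is_derive1_sinM (t s : R) :
  is_derive s 1 (fun s : R => sin (t * s)) (t * cos (t * s)).
Proof.
have h : is_derive s 1 (@sin R \o ( *%R t)) (cos (t * s) * t).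
  apply: is_derive1_comp.
  exact: is_derive1_mull.
by apply: (is_derive_eq h); rewrite mulrC.
Qed.

Lemma is_derive1_cosM (t s : R) :
  is_derive s 1 (fun s : R => cos (t * s)) (- (t * sin (t * s))).
Proof.
have h : is_derive s 1 (@cos R \o ( *%R t)) (- sin (t * s) * t).
  apply: is_derive1_comp.
  exact: is_derive1_mull.
by apply: (is_derive_eq h); rewrite mulrC mulrN.
Qed.

Lemma continuous_of_derive (f df : R -> R) :
  (forall s, is_derive s 1 f (df s)) -> continuous f.
Proof.
move=> h s; apply/differentiable_continuous/derivable1_diffP.
by have [] := h s.
Qed.

Lemma continuous_sinM t : continuous (fun s => sin (t * s)).
Proof. exact: continuous_of_derive (is_derive1_sinM t). Qed.

Lemma continuous_cosM t : continuous (fun s => cos (t * s)).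
Proof. exact: continuous_of_derive (is_derive1_cosM t). Qed.

Lemma continuous_cmul c (p : R -> R) : continuous p -> continuous (fun s => c * p s).
Proof. by move=> cp s; apply: cvgM; [exact: cvg_cst|exact: cp]. Qed.

Lemma continuous_mul (p q : R -> R) : continuous p -> continuous q ->
  continuous (fun s => p s * q s).
Proof. by move=> cp cq s; apply: cvgM; [exact: cp|exact: cq]. Qed.

Lemma measurable_sinM t : measurable_fun setT (fun s : R => sin (t * s)).
Proof. by apply: continuous_measurable_fun; exact: continuous_sinM. Qed.

Lemma measurable_cosM t : measurable_fun setT (fun s : R => cos (t * s)).
Proof. by apply: continuous_measurable_fun; exact: continuous_cosM. Qed.

Lemma measurable_inv : measurable_fun setT (@GRing.inv R).
Proof.
have mD : measurable (~` [set 0] : set R) by exact: measurableC.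
rewrite -(setUv [set (0 : R)]); apply/measurable_funU => //.
split; first exact: measurable_fun_set1.
apply: open_continuous_measurable_fun; first exact: closed_openC.
by move=> x; rewrite inE => /eqP x0; exact: inv_continuous.
Qed.

Lemma normr_sin_le y : `|sin y| <= `|y| :> R.
Proof.
wlog y0 : y / 0 <= y.
  move=> h; have [/h//|/ltW y0] := leP 0 y.
  by rewrite -(normrN y) -(normrN (sin y)) -sinN h// oppr_ge0.
have [|c _] := @MVT_segment R (@sin R) (@cos R) 0 y y0 _.
  by apply: continuous_subspaceT; exact: continuous_sin.
by rewrite sin0 !subr0 => ->; rewrite normrM ler_piMl// cos_max.
Qed.

Lemma normr_1Bcos_le y : `|1 - cos y| <= `|y|.
Proof.
wlog y0 : y / 0 <= y.
  move=> h; have [/h//|/ltW y0] := leP 0 y.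
  by rewrite -cosN -(normrN y) h// oppr_ge0.
have [|c _] := @MVT_segment R (@cos R) (fun t => - sin t) 0 y y0 _.
  by apply: continuous_subspaceT; exact: continuous_cos.
rewrite cos0 subr0 distrC => ->.
by rewrite normrM normrN ler_piMl// sin_max.
Qed.

End derivatives.

Section real_line.
Context {R : realType}.
Notation leb := (@lebesgue_measure R).
Implicit Types (f u : R -> R).

Lemma Rintegral_FTC (f F : R -> R) a b : a <= b -> continuous f ->
  (forall x : R, is_derive x 1 F (f x)) ->
  \int[leb]_(x in `[a, b]) f x = F b - F a.
Proof.
move=> + cf dF; rewrite le_eqVlt => /predU1P[->|ab].
  by rewrite set_itv1 Rintegral_set1 subrr.
have cF : continuous F.
  by move=> x; apply/differentiable_continuous/derivable1_diffP; have [] := dF x.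
rewrite /Rintegral (continuous_FTC2 ab _ _ (F := F))//.
- exact: continuous_subspaceT.
- split.
  + by move=> x _; have [] := dF x.
  + exact/cvg_at_right_filter/cF.
  + exact/cvg_at_left_filter/cF.
- by move=> x _; rewrite derive1E; have [] := dF x.
Qed.

Lemma integrable_itv f (a b : R) : continuous f ->
  leb.-integrable `[a, b] (EFin \o f).
Proof.
move=> cf; apply: continuous_compact_integrable; first exact: segment_compact.
exact: continuous_subspaceT.
Qed.

Lemma integrable_truncated f (b : R) : continuous f ->
  leb.-integrable setT (EFin \o (f \_ `[0, b])).
Proof.
move=> cf; rewrite -restrict_EFin.
apply: (@integrable_mkcond _ _ _ leb `[0, b]%classic (EFin \o f) _).1 => //.
exact: integrable_itv.
Qed.

Lemma Rintegral_opp u : leb.-integrable setT (EFin \o u) ->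
  \int[leb]_t u (- t) = \int[leb]_t u t.
Proof.
move=> iu; have mu_ := measurable_int _ iu.
have mN : measurable_fun [set: measurableTypeR R] (-%R : R -> measurableTypeR R).
  exact: oppr_measurable.
have pushE (g : R -> \bar R) :
    (\int[pushforward leb (-%R : R -> measurableTypeR R)]_t g t =
     \int[leb]_t g t)%E.
  by apply: eq_measure_integral => A mA _; exact: lebesgue_measureN.
have iuN : leb.-integrable ((-%R : R -> measurableTypeR R) @^-1` setT)
    ((EFin \o u) \o (-%R : R -> measurableTypeR R)).
  rewrite preimage_setT; apply/integrableP; split.
    exact: measurableT_comp mu_ mN.
  have /integrableP[_] := iu; rewrite -pushE ge0_integral_pushforward//.
  exact: measurableT_comp.
congr fine; rewrite -[RHS]pushE.
have := integral_pushforward mN mu_ iuN measurableT.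
by rewrite preimage_setT => ->.
Qed.

Lemma Rintegral_odd u : leb.-integrable setT (EFin \o u) ->
  (forall t, u (- t) = - u t) -> \int[leb]_t u t = 0.
Proof.
move=> iu uN; apply/eqP; rewrite -[_ == 0](@mulrn_eq0 _ _ 2) mulr2n.
rewrite -{1}Rintegral_opp// -RintegralD//.
  under eq_Rintegral do rewrite uN addNr.
  by rewrite Rintegral_cst// mul0r.
rewrite (_ : _ \o _ = -%E \o (EFin \o u)); first exact: integrableN.
by apply/funext => t /=; rewrite uN.
Qed.

Lemma Rintegral_even_eq0 u : leb.-integrable setT (EFin \o u) ->
  (forall t, u (- t) = u t) -> \int[leb]_(t in `[0, +oo[) u t = 0 ->
  \int[leb]_t u t = 0.
Proof.
move=> iu uN u0.
have iS (D : set R) : measurable D -> leb.-integrable D (EFin \o u).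
  by move=> mD; apply: integrableS iu.
have iP (D : set R) : measurable D -> leb.-integrable setT (EFin \o (u \_ D)).
  move=> mD; rewrite -restrict_EFin.
  exact: (@integrable_mkcond _ _ _ leb D (EFin \o u) mD).1 (iS _ mD).
have {1}-> : [set: R] = `[0, +oo[ `|` `]-oo, 0[.
  apply/seteqP; split => t //= _.
  by rewrite !in_itv/= andbT; case: (leP 0 t); [left|right].
rewrite Rintegral_setU//; last 2 first.
- by apply: iS; exact: measurableU.
- apply/disj_setPS => t [] /=; rewrite !in_itv/= andbT => t0.
  by rewrite ltNge t0.
rewrite u0 add0r.
rewrite -[RHS]u0 Rintegral_mkcond -Rintegral_opp; last exact: iP.
rewrite -[RHS]Rintegral_itv_obnd_cbnd; last exact: iS.
rewrite [RHS]Rintegral_mkcond; apply: eq_Rintegral => t _.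
rewrite !patchE uN; congr (if _ then _ else _).
by rewrite !mem_setE !in_itv/= andbT oppr_lt0.
Qed.

Lemma Rintegral_gt0 (f : R -> R) b c : 0 < b -> 0 < c ->
  leb.-integrable setT (EFin \o f) -> (forall t, 0 <= f t) ->
  (forall t, 0 <= t <= b -> c <= f t) -> 0 < \int[leb]_t f t.
Proof.
move=> b0 c0 intf f0 fc.
have ic : leb.-integrable setT (EFin \o (cst c \_ `[0, b])).
  by apply: integrable_truncated => t; exact: cvg_cst.
apply: (@lt_le_trans _ _ (\int[leb]_t (cst c \_ `[0, b]) t)).
  rewrite -Rintegral_mkcond Rintegral_cst//= lebesgue_measure_itv/= lte_fin b0.
  by rewrite oppr0 adde0 mulr_gt0.
apply: le_Rintegral => // t _; rewrite patchE mem_setE in_itv/=.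
by case: ifPn => // /fc.
Qed.

Lemma integrable_oneDsqrV : leb.-integrable setT (EFin \o (fun t => (1 + t ^+ 2)^-1)).
Proof.
have c := @continuous_oneDsqrV R.
apply/integrableP; split.
  apply/measurable_EFinP; exact: continuous_measurable_fun c.
under eq_integral => t _ do rewrite /= ger0_norm ?invr_ge0 ?addr_ge0 ?sqr_ge0//.
rewrite (ge0_symfun_integralT _ c).
- rewrite -set_itvcy integral0y_oneDsqr -EFinM ltry//.
- by move=> t; rewrite invr_ge0 addr_ge0 ?sqr_ge0.
- by move=> t; rewrite /= /oneDsqr sqrrN.
Qed.

Lemma integrable_quadratic_decay (f : R -> R) C : measurable_fun setT f ->
  (forall t, `|f t| * (1 + t ^+ 2) <= C) -> leb.-integrable setT (EFin \o f).
Proof.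
move=> mf fC; apply: (@le_integrable_real _ _ _ leb f (fun t => C * (1 + t ^+ 2)^-1)) => //.
  by move=> t; rewrite ler_pdivlMr// ltr_pwDl// sqr_ge0.
rewrite (_ : _ \o _ = (fun t => C%:E * ((1 + t ^+ 2)^-1)%:E)%E); last first.
  by apply/funext => t /=; rewrite EFinM.
by apply: integrableZl => //; exact: integrable_oneDsqrV.
Qed.

End real_line.

(** * The cosine transform *)

Section cosine_transform.
Context {R : realType}.
Notation leb := (@lebesgue_measure R).
Implicit Types (u k m : R -> R) (x t : R).

Definition cos_transform u x : R := \int[leb]_t (u t * cos (x * t)).

Lemma integrable_mul_cos u x : leb.-integrable setT (EFin \o u) ->
  leb.-integrable setT (EFin \o (fun t => u t * cos (x * t))).
Proof.
move=> iu; apply: (integrable_mul_bounded (M := 1) iu).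
  exact: measurable_cosM.
by move=> t; exact: cos_max.
Qed.

Lemma integrable_mul_sin u x : leb.-integrable setT (EFin \o u) ->
  leb.-integrable setT (EFin \o (fun t => u t * sin (x * t))).
Proof.
move=> iu; apply: (integrable_mul_bounded (M := 1) iu).
  exact: measurable_sinM.
by move=> t; exact: sin_max.
Qed.

Lemma sin_transform_even (f : R -> R) x : leb.-integrable setT (EFin \o f) ->
  (forall t, f (- t) = f t) -> \int[leb]_t (f t * sin (x * t)) = 0.
Proof.
move=> intf fN; apply: Rintegral_odd; first exact: integrable_mul_sin.
by move=> t; rewrite fN mulrN sinN mulrN.
Qed.

Lemma normr_cos_transform_le u x : leb.-integrable setT (EFin \o u) ->
  `|cos_transform u x| <= \int[leb]_t `|u t|.
Proof.
move=> iu; apply: le_trans (le_normr_Rintegral _ _) _ => //.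
  exact: integrable_mul_cos.
apply: le_Rintegral => //.
- by apply: (@integrable_norm _ _ _ leb); exact: integrable_mul_cos.
- exact: (@integrable_norm _ _ _ leb).
- by move=> t _; rewrite normrM ler_piMr// cos_max.
Qed.

Lemma cos_transform_truncated u (b x : R) : cos_transform (u \_ `[0, b]) x =
  \int[leb]_(s in `[0, b]) (u s * cos (x * s)).
Proof.
rewrite [RHS]Rintegral_mkcond; apply: eq_Rintegral => s _.
by rewrite !patchE; case: ifPn => //; rewrite mul0r.
Qed.

Section multiplication_formula.
Variables k m : R -> R.
Hypotheses (ik : leb.-integrable setT (EFin \o k))
           (im : leb.-integrable setT (EFin \o m)).

Let F (p : R * R) : R := k p.1 * m p.2 * cos (p.1 * p.2).

Let iF : (leb \x leb)%E.-integrable setT (EFin \o F).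
Proof.
apply: (integrable_mul_bounded (M := 1)).
- exact: integrable_prod.
- apply: (@measurableT_comp _ _ _ _ _ _ (@cos R)); last exact: measurable_funM.
  by apply: continuous_measurable_fun; exact: continuous_cos.
- by move=> p; exact: cos_max.
Qed.

Let section1 x : (\int[leb]_y (F (x, y))%:E = (k x * cos_transform m x)%:E)%E.
Proof.
under eq_integral do rewrite /F/= -mulrA EFinM.
have ic := integrable_mul_cos x im.
by rewrite integralZl// EFinM /cos_transform fineK//; exact: integrable_fin_num.
Qed.

Let section2 y : (\int[leb]_x (F (x, y))%:E = (m y * cos_transform k y)%:E)%E.
Proof.
under eq_integral do rewrite /F/= mulrAC mulrC (mulrC _ y) EFinM.
have ic := integrable_mul_cos y ik.
by rewrite integralZl// EFinM /cos_transform fineK//; exact: integrable_fin_num.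
Qed.

Lemma integrable_mul_cos_transform :
  leb.-integrable setT (EFin \o (fun t => k t * cos_transform m t)).
Proof.
have := integrable_fubini_F iF; apply: eq_integrable => // x _.
exact: section1.
Qed.

(** The kernel [cos (t * s)] is symmetric in [t] and [s]. *)
Lemma cos_transform_mult :
  \int[leb]_t (k t * cos_transform m t) = \int[leb]_s (m s * cos_transform k s).
Proof.
congr fine; transitivity (\int[leb]_x \int[leb]_y (F (x, y))%:E)%E.
  by apply: eq_integral => x _; rewrite section1.
by rewrite (Fubini iF); apply: eq_integral => y _; exact: section2.
Qed.

End multiplication_formula.

End cosine_transform.

(** * Summation by the Fejer kernel *)

Section summability.
Context {R : realType}.
Notation leb := (@lebesgue_measure R).
Implicit Types (u m : R -> R) (x t s y N M sigma : R).

(** One half of the Fejer window; for even functions it is enough to integrate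
    over the positive half-line, and then no absolute value is needed. *)
Definition fejer N : R -> R := (fun t => 1 - t / N) \_ `[0, N].

(** The Fejer kernel.  At [y = 0] this formula gives 0 by the convention on
    division, whereas the transform of [fejer N] is [N / 2] there. *)
Definition fejer_hat N y : R := (1 - cos (y * N)) / (N * y ^+ 2).

Lemma fejer_bound N t : 0 < N -> `|fejer N t| <= 1.
Proof.
move=> N0; rewrite /fejer patchE mem_setE in_itv/=; case: ifPn => [/andP[t0 tN]|_].
  have tN1 : t / N <= 1 by rewrite ler_pdivrMr// mul1r.
  have tN0 : 0 <= t / N by rewrite divr_ge0// ltW.
  by rewrite ger0_norm; lra.
by rewrite normr0.
Qed.

Lemma fejer_cvg t : fejer n.+1%:R t @[n --> \oo] --> ((0 <= t)%R%:R : R).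
Proof.
have [t0|t0] := boolP (0 <= t); last first.
  under eq_fun do rewrite /fejer patchE mem_setE in_itv/= (negbTE t0)/=.
  exact: cvg_cst.
have h : (1 - t * n.+1%:R^-1) @[n --> \oo] --> (1 : R).
  rewrite -[X in _ --> X]subr0; apply: cvgB; first exact: cvg_cst.
  rewrite -[X in _ --> X](mulr0 t); apply: cvgM; first exact: cvg_cst.
  exact: cvg_harmonic.
apply: cvg_trans h; apply: near_eq_cvg; near=> n.
rewrite /fejer patchE mem_setE in_itv/= t0/= ifT//.
near: n; apply: filterS (nbhs_infty_ger t) => n /le_trans; apply.
by rewrite ler_nat.
Unshelve. all: by end_near. Qed.

Lemma measurable_fejer N : measurable_fun setT (fejer N).
Proof.
apply/measurable_restrict => //; apply: measurable_funB => //.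
exact: measurable_funM.
Qed.

Lemma integrable_fejer N : leb.-integrable setT (EFin \o fejer N).
Proof.
apply: integrable_truncated => t; apply: cvgB; first exact: cvg_cst.
exact: mulrr_continuous.
Qed.

Lemma cos_transform_fejer N y : 0 < N -> y != 0 ->
  cos_transform (fejer N) y = fejer_hat N y.
Proof.
move=> N0 y0; pose G t := (1 - t / N) * (sin (y * t) / y) - cos (y * t) / (N * y ^+ 2).
rewrite /fejer cos_transform_truncated.
have cf : continuous (fun t : R => (1 - t / N) * cos (y * t)).
  move=> t; apply: cvgM.
    by apply: cvgB; [exact: cvg_cst|exact: mulrr_continuous].
  apply: (@continuous_comp _ _ _ (fun t => y * t) (@cos R)).
    exact: mulrl_continuous.
  exact: continuous_cos.
have dG t : is_derive t 1 G ((1 - t / N) * cos (y * t)).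
  have h1 : is_derive t 1 (fun t : R => 1 - t / N) (- N^-1).
    have h : is_derive t 1 (fun t : R => cst 1 t - N^-1 * t) (0 - N^-1).
      by apply: is_deriveB; exact: is_derive1_mull.
    rewrite sub0r in h; rewrite (_ : (fun t => _) = (fun t : R => cst 1 t - N^-1 * t))//.
    by apply/funext => z; rewrite mulrC.
  have h2 : is_derive t 1 (fun t : R => sin (y * t) / y) (cos (y * t)).
    have h : is_derive t 1 (fun t : R => y^-1 *: sin (y * t)) _ :=
      is_deriveZ y^-1 (is_derive1_sinM y t).
    rewrite (_ : (fun t => _) = (fun t : R => y^-1 *: sin (y * t)))//.
      by apply: (is_derive_eq h); rewrite /GRing.scale/= mulKf.
    by apply/funext => z; rewrite mulrC.
  have h3 : is_derive t 1 (fun t : R => cos (y * t) / (N * y ^+ 2))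
      (- (sin (y * t) / (N * y))).
    have h : is_derive t 1 (fun t : R => (N * y ^+ 2)^-1 *: cos (y * t)) _ :=
      is_deriveZ (N * y ^+ 2)^-1 (is_derive1_cosM y t).
    rewrite (_ : (fun t => _) = (fun t : R => (N * y ^+ 2)^-1 *: cos (y * t)))//.
      apply: (is_derive_eq h); rewrite /GRing.scale/=; field.
      by rewrite y0 gt_eqF.
    by apply/funext => z; rewrite mulrC.
  have h : is_derive t 1 G _ := is_deriveB (is_deriveM h1 h2) h3.
  apply: (is_derive_eq h); rewrite /GRing.scale/=; field.
  by rewrite y0 gt_eqF.
rewrite (Rintegral_FTC (ltW N0) cf dG).
rewrite /G /fejer_hat !mulr0 sin0 cos0 divff ?gt_eqF// subrr mul0r.
by field; rewrite y0 gt_eqF.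
Qed.

(** The kernel has height of order [N] but it is only integrated against
    functions that are [O(y)] near 0, for which this bound is uniform in [N]. *)
Lemma fejer_hat_bound N y : 0 < N -> `|y| * `|fejer_hat N y| <= 1.
Proof.
move=> N0; have [->|y0] := eqVneq y 0; first by rewrite normr0 mul0r.
have ny : 0 < `|y| by rewrite normr_gt0.
rewrite normrM normfV normrM normrX (gtr0_norm N0) mulrCA.
rewrite (_ : `|y| / _ = (N * `|y|)^-1); last by field; rewrite !gt_eqF.
rewrite ler_pdivrMr ?mulr_gt0// mul1r (le_trans (normr_1Bcos_le _))//.
by rewrite normrM (gtr0_norm N0) mulrC.
Qed.

Lemma fejer_hat_cvg0 y : fejer_hat n.+1%:R y @[n --> \oo] --> (0 : R).
Proof.
apply/cvgr0Pnorm_le => /= e e0.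
have : (fun n => 2 / y ^+ 2 * n.+1%:R^-1) @ \oo --> (0 : R).
  rewrite -[X in _ --> X](mulr0 (2 / y ^+ 2)); apply: cvgMl_tmp.
  exact: cvg_harmonic.
move=> /cvgr0Pnorm_le /(_ e e0); apply: filterS => n; apply: le_trans.
have -> : fejer_hat n.+1%:R y = (1 - cos (y * n.+1%:R)) / y ^+ 2 * n.+1%:R^-1.
  by rewrite /fejer_hat invfM mulrA mulrAC.
rewrite normrM [leRHS]normrM ler_wpM2r//.
rewrite normrM [leRHS]normrM ler_wpM2r// ler_norml ger0_norm//.
by move: (cos_le1 (y * n.+1%:R)) (cos_geN1 (y * n.+1%:R)); lra.
Qed.

Lemma cos_transform_fejer_cos N x s : 0 < N -> s - x != 0 -> s + x != 0 ->
  cos_transform (fun t => fejer N t * cos (x * t)) s =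
  (fejer_hat N (s - x) + fejer_hat N (s + x)) / 2.
Proof.
move=> N0 sx1 sx2; rewrite -!cos_transform_fejer// /cos_transform -RintegralD//; last 2 first.
- by apply: integrable_mul_cos; exact: integrable_fejer.
- by apply: integrable_mul_cos; exact: integrable_fejer.
rewrite -RintegralZr//; last first.
  rewrite (_ : _ \o _ = (EFin \o (fun t => fejer N t * cos ((s - x) * t))) \+
    (EFin \o (fun t => fejer N t * cos ((s + x) * t))))//.
  by apply: integrableD => //; apply: integrable_mul_cos; exact: integrable_fejer.
by apply: eq_Rintegral => t _; rewrite mulrBl cosB (mulrDl s x t) cosD; field.
Qed.

Lemma measurable_fejer_hat N : measurable_fun setT (fejer_hat N).
Proof.
apply: measurable_funM.
  apply: measurable_funB => //.
  rewrite (_ : (fun y => cos (y * N)) = (fun y => cos (N * y))).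
    exact: measurable_cosM.
  by apply/funext => y; rewrite mulrC.
apply: (measurableT_comp (@measurable_inv R)).
by apply: measurable_funM => //; exact: measurable_funX.
Qed.

(** By symmetry of the cosine transform, the Fejer means of the integral of
    [u t * cos (x * t)] are integrals of [m] against Fejer kernels centred at
    [x] and [- x].  The Lipschitz bounds on [m] make the integrands uniformly
    bounded, and they tend to 0 pointwise, so the means tend to 0. *)
Lemma cos_transform_eq0 u m sigma M x :
  leb.-integrable setT (EFin \o u) -> leb.-integrable setT (EFin \o m) ->
  (forall t, u (- t) = u t) ->
  {ae leb, forall t, u t = cos_transform m t} ->
  (forall s, `|m s| <= M * `|s - x|) -> (forall s, `|m s| <= M * `|s + x|) ->
  (forall s, ~ `[0, sigma]%classic s -> m s = 0) ->
  cos_transform u x = 0.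
Proof.
move=> iu im uN um m1 m2 msupp.
have mu_ : measurable_fun setT u := integrable_measurable iu.
have mm : measurable_fun setT m := integrable_measurable im.
apply: Rintegral_even_eq0; first exact: integrable_mul_cos.
  by move=> t; rewrite uN mulrN cosN.
rewrite Rintegral_mkcond.
pose f_ n t := u t * (fejer n.+1%:R t * cos (x * t)).
pose f0 := (fun t => u t * cos (x * t)) \_ `[0, +oo[.
pose A n := \int[leb]_t f_ n t.
have Acvg : A n @[n --> \oo] --> \int[leb]_t f0 t.
  apply: (@Rintegral_dominated_cvg _ _ _ leb f_ f0 (fun t => `|u t|)).
  - move=> n; apply: measurable_funM => //; apply: measurable_funM.
      exact: measurable_fejer.
    exact: measurable_cosM.
  - apply/measurable_restrict => //; apply: measurable_funTS.
    by apply: measurable_funM => //; exact: measurable_cosM.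
  - move=> t; rewrite /f0 /f_.
    have -> : ((fun t => u t * cos (x * t)) \_ `[0, +oo[) t =
        u t * ((0 <= t)%R%:R * cos (x * t)) :> R.
      rewrite patchE mem_setE in_itv/= andbT.
      by case: ifPn => _; rewrite ?mul1r// mul0r mulr0.
    apply: cvgM; first exact: cvg_cst.
    by apply: cvgM; [exact: fejer_cvg|exact: cvg_cst].
  - exact: (@integrable_norm _ _ _ leb).
  - move=> n t; rewrite normrM ler_piMr// normrM mulr_ile1//.
      exact: fejer_bound.
    exact: cos_max.
have AE n : A n = \int[leb]_s (m s * ((fejer_hat n.+1%:R (s - x) + fejer_hat n.+1%:R (s + x)) / 2)).
  have ik : leb.-integrable setT (EFin \o (fun t => fejer n.+1%:R t * cos (x * t))).
    by apply: integrable_mul_cos; exact: integrable_fejer.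
  transitivity (\int[leb]_t (fejer n.+1%:R t * cos (x * t) * cos_transform m t)).
    congr fine; apply: ae_eq_integral => //.
    - apply/measurable_EFinP; apply: measurable_funM => //; apply: measurable_funM.
        exact: measurable_fejer.
      exact: measurable_cosM.
    - exact: measurable_int (integrable_mul_cos_transform ik im).
    - case: um => N [mN N0 subN]; exists N; split => // t /= ut; apply: subN => /= utE.
      by apply: ut => _; rewrite -utE mulrC.
  rewrite cos_transform_mult//; apply: eq_Rintegral => s _.
  (* fejer_hat has the wrong value at 0, but m vanishes at x and - x. *)
  have [s1|s1] := eqVneq (s - x) 0.
    by move: (m1 s); rewrite s1 normr0 mulr0 normr_le0 => /eqP ->; rewrite !mul0r.
  have [s2|s2] := eqVneq (s + x) 0.
    by move: (m2 s); rewrite s2 normr0 mulr0 normr_le0 => /eqP ->; rewrite !mul0r.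
  by rewrite cos_transform_fejer_cos.
have A0 : A n @[n --> \oo] --> (0 : R).
  pose g_ n s := m s * ((fejer_hat n.+1%:R (s - x) + fejer_hat n.+1%:R (s + x)) / 2).
  rewrite (_ : A = fun n => \int[leb]_s g_ n s); last exact/funext.
  rewrite (_ : 0 = \int[leb]_s (cst 0 : R -> R) s); last by rewrite Rintegral_cst// mul0r.
  apply: (@Rintegral_dominated_cvg _ _ _ leb g_ (cst 0) (cst `|M| \_ `[0, sigma])).
  - move=> n; apply: measurable_funM => //; apply: measurable_funM => //.
    by apply: measurable_funD; apply: (measurableT_comp (measurable_fejer_hat _));
      [exact: measurable_funB|exact: measurable_funD].
  - exact: measurable_cst.
  - move=> t.
    rewrite /= -[X in _ --> X](mulr0 (m t)); apply: cvgMl_tmp.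
    rewrite -[X in _ --> X](mul0r (2^-1)); apply: cvgMr_tmp.
    rewrite -[X in _ --> X](addr0 0); apply: cvgD; exact: fejer_hat_cvg0.
  - by apply: integrable_truncated => t; exact: cvg_cst.
  - move=> n s; rewrite patchE; case: ifPn => [_|]; last first.
      by rewrite notin_setE => /msupp ms0; rewrite /g_ ms0 mul0r normr0.
    have K y : `|m s| <= M * `|y| -> `|m s| * `|fejer_hat n.+1%:R y| <= `|M|.
      move=> my; apply: (@le_trans _ _ (`|M| * (`|y| * `|fejer_hat n.+1%:R y|))).
        by rewrite mulrA ler_wpM2r// (le_trans my)// ler_wpM2r// ler_norm.
      by rewrite ler_piMr// fejer_hat_bound.
    rewrite /g_ normrM normrM (ger0_norm (_ : 0 <= 2^-1))//.
    have := K _ (m1 s); have := K _ (m2 s).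
    set a := fejer_hat _ (s + x); set b := fejer_hat _ (s - x) => h1 h2.
    rewrite /cst/= mulrA ler_pdivrMr// (@le_trans _ _ (`|m s| * (`|b| + `|a|)))//.
      by rewrite ler_wpM2l// ler_normD.
    by rewrite mulrDr; lra.
exact: cvg_unique Acvg A0.
Qed.

Lemma cos_transform_outside u m sigma B x : 0 < sigma ->
  leb.-integrable setT (EFin \o u) -> leb.-integrable setT (EFin \o m) ->
  (forall t, u (- t) = u t) ->
  {ae leb, forall t, u t = cos_transform m t} ->
  (forall s, `|m s| <= B) ->
  (forall s, ~ `[0, sigma]%classic s -> m s = 0) ->
  sigma < `|x| -> cos_transform u x = 0.
Proof.
move=> sigma0 iu im uN um mB ms sx; have d0 : 0 < `|x| - sigma by rewrite subr_gt0.
have B0 : 0 <= B by exact: le_trans (mB 0).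
(* The support of m stays at distance at least |x| - sigma from x and - x. *)
have K s y : `|y| = `|x| -> `|m s| <= B / (`|x| - sigma) * `|s + y|.
  move=> yx; have [/andP[s0 s1]|ns] := boolP (0 <= s <= sigma); last first.
    rewrite ms; last by rewrite /= in_itv/=; exact/negP.
    by rewrite normr0 mulr_ge0// divr_ge0// ltW.
  apply: (le_trans (mB s)); rewrite mulrAC ler_pdivlMr// ler_wpM2l//.
  rewrite lerBlDr -yx -{1}(addKr s y) addrC.
  by rewrite (le_trans (ler_normB _ _))// lerD// ger0_norm.
apply: (cos_transform_eq0 (m := m) (sigma := sigma) (M := B / (`|x| - sigma))) => // s.
  by apply: (K s (- x)); rewrite normrN.
exact: K.
Qed.

End summability.

(** * A pair of band-limited functions *)

Section window.
Context {R : realType}.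
Notation leb := (@lebesgue_measure R).
Implicit Types (s t x sigma : R).

Definition freq sigma : R := pi / sigma.

(** The zeros of [1 + cos (sigma * t)] at [freq sigma] and its opposite are
    double, so the quotient extends smoothly there; division by zero gives it the
    value 0 at these two points instead, a change on a null set. *)
Definition window sigma t : R :=
  (1 + cos (sigma * t)) / (t ^+ 2 - freq sigma ^+ 2) ^+ 2.

Definition swindow sigma t : R := (t ^+ 2 - freq sigma ^+ 2) * window sigma t.

(** With [a = freq sigma], the solution of
      [y'' + a ^+ 2 * y = 2 * a ^+ 2 * sin (a * s)]
    such that [y' 0 = 0] and [y sigma = y' sigma = 0].  These are the conditions
    under which integrating [y s * cos (t * s)] by parts twice over
    [`[0, sigma]] leaves no boundary terms. *)
Definition profile sigma s : R :=
  freq sigma * ((sigma - s) * cos (freq sigma * s)) + sin (freq sigma * s).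

Definition window_spec sigma : R -> R :=
  (fun s => (2 * freq sigma ^+ 3)^-1 * profile sigma s) \_ `[0, sigma].

Definition swindow_spec sigma : R -> R :=
  (fun s => - (freq sigma)^-1 * sin (freq sigma * s)) \_ `[0, sigma].

Section fixed_sigma.
Variable sigma : R.
Hypothesis sigma0 : 0 < sigma.
Let a := freq sigma.

Lemma freq_gt0 : 0 < a. Proof. by rewrite divr_gt0// pi_gt0. Qed.

Lemma freqM : a * sigma = pi.
Proof. by rewrite /a /freq divfK// gt_eqF. Qed.

Let profile' s : R := - (a ^+ 2 * ((sigma - s) * sin (a * s))).

Lemma is_derive_profile s : is_derive s 1 (profile sigma) (profile' s).
Proof.
have h := is_deriveD
  (is_derive1_mulr a (is_derive1_mul (is_derive1_subl sigma s) (is_derive1_cosM a s)))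
  (is_derive1_sinM a s).
by apply: (is_derive_eq h); rewrite /profile'; ring.
Qed.

Lemma is_derive_profile' s : is_derive s 1 profile'
  (a ^+ 2 * sin (a * s) - a ^+ 3 * ((sigma - s) * cos (a * s))).
Proof.
have h := is_deriveN
  (is_derive1_mulr (a ^+ 2) (is_derive1_mul (is_derive1_subl sigma s) (is_derive1_sinM a s))).
by apply: (is_derive_eq h); ring.
Qed.

(** This primitive is the Wronskian [f' * g - f * g'] of [f s = sin (a * s)] and
    [g s = cos (t * s)], whose derivative is [f'' * g - f * g'']. *)
Lemma is_derive_swindow_prim t s :
  is_derive s 1 (fun s => t * (sin (a * s) * sin (t * s)) + a * (cos (a * s) * cos (t * s)))
   ((t ^+ 2 - a ^+ 2) * (sin (a * s) * cos (t * s))).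
Proof.
have h := is_deriveD
  (is_derive1_mulr t (is_derive1_mul (is_derive1_sinM a s) (is_derive1_sinM t s)))
  (is_derive1_mulr a (is_derive1_mul (is_derive1_cosM a s) (is_derive1_cosM t s))).
by apply: (is_derive_eq h); ring.
Qed.

(** The Wronskian of [profile sigma] and [cos (t * s)] has a derivative with an
    additional term [2 * a ^+ 2 * sin (a * s) * cos (t * s)], coming from the
    right-hand side of the equation of [profile sigma]; multiplication by
    [t ^+ 2 - a ^+ 2] makes it [2 * a ^+ 2] times the derivative given by
    [is_derive_swindow_prim]. *)
Lemma is_derive_window_prim t s :
  is_derive s 1 (fun s => (t ^+ 2 - a ^+ 2) *
      (t * (profile sigma s * sin (t * s)) + profile' s * cos (t * s)) -
    2 * a ^+ 2 * (t * (sin (a * s) * sin (t * s)) + a * (cos (a * s) * cos (t * s))))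
   ((t ^+ 2 - a ^+ 2) ^+ 2 * (profile sigma s * cos (t * s))).
Proof.
have h := is_deriveB
  (is_derive1_mulr (t ^+ 2 - a ^+ 2) (is_deriveD
    (is_derive1_mulr t (is_derive1_mul (is_derive_profile s) (is_derive1_sinM t s)))
    (is_derive1_mul (is_derive_profile' s) (is_derive1_cosM t s))))
  (is_derive1_mulr (2 * a ^+ 2) (is_derive_swindow_prim t s)).
by apply: (is_derive_eq h); rewrite /profile /profile' -/a; ring.
Qed.

Lemma continuous_profile : continuous (profile sigma).
Proof. exact: continuous_of_derive is_derive_profile. Qed.

Lemma integrable_swindow_spec : leb.-integrable setT (EFin \o swindow_spec sigma).
Proof. apply: integrable_truncated; apply: continuous_cmul; exact: continuous_sinM. Qed.

Lemma integrable_window_spec : leb.-integrable setT (EFin \o window_spec sigma).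
Proof. apply: integrable_truncated; apply: continuous_cmul; exact: continuous_profile. Qed.

Lemma integral_cos_FTC (p G : R -> R) c t : continuous p ->
  (forall s, is_derive s 1 G (c * (p s * cos (t * s)))) ->
  c * \int[leb]_(s in `[0, sigma]) (p s * cos (t * s)) = G sigma - G 0.
Proof.
move=> cp dG; have cpc := continuous_mul cp (@continuous_cosM R t).
rewrite -RintegralZl//; last exact: integrable_itv.
by apply: Rintegral_FTC => //; [exact: ltW|exact: continuous_cmul].
Qed.

Lemma cos_transform_swindow_spec t : t ^+ 2 != a ^+ 2 ->
  cos_transform (swindow_spec sigma) t = swindow sigma t.
Proof.
rewrite -subr_eq0 => ta; have a0 := freq_gt0.
rewrite /swindow_spec cos_transform_truncated.
under eq_Rintegral do rewrite -mulrA.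
have cs := continuous_mul (@continuous_sinM R a) (@continuous_cosM R t).
rewrite RintegralZl//; last exact: integrable_itv.
have := integral_cos_FTC (@continuous_sinM R a) (is_derive_swindow_prim t).
rewrite !mulr0 !sin0 !cos0 freqM sinpi cospi => h.
apply: (mulfI ta); rewrite mulrCA h /swindow /window -/a (mulrC sigma); field.
by rewrite ta gt_eqF.
Qed.

Lemma cos_transform_window_spec t : t ^+ 2 != a ^+ 2 ->
  cos_transform (window_spec sigma) t = window sigma t.
Proof.
rewrite -subr_eq0 => ta; have a0 := freq_gt0.
rewrite /window_spec cos_transform_truncated.
under eq_Rintegral do rewrite -mulrA.
have cs := continuous_mul continuous_profile (@continuous_cosM R t).
rewrite RintegralZl//; last exact: integrable_itv.
have := integral_cos_FTC continuous_profile (is_derive_window_prim t).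
rewrite /profile /profile' -/a !mulr0 !sin0 !cos0 freqM sinpi cospi => h.
apply: (mulfI (expf_neq0 2 ta)); rewrite mulrCA h /window -/a (mulrC sigma); field.
by rewrite ta gt_eqF.
Qed.

Lemma ae_off_poles (P : R -> Prop) :
  (forall t, t ^+ 2 != a ^+ 2 -> P t) -> {ae leb, forall t, P t}.
Proof.
move=> h; exists ([set a] `|` [set - a]); split.
- exact: measurableU.
- by apply: null_set_setU => //; exact: lebesgue_measure_set1.
- move=> t /= nP; have [|ta] := eqVneq (t ^+ 2) (a ^+ 2); last by case: nP; exact: h.
  by move/eqP; rewrite eqf_sqr => /orP[/eqP|/eqP]; [left|right].
Qed.

Lemma ae_window_spec : {ae leb, forall t, window sigma t = cos_transform (window_spec sigma) t}.
Proof. by apply: ae_off_poles => t ta; rewrite cos_transform_window_spec. Qed.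

Lemma ae_swindow_spec : {ae leb, forall t, swindow sigma t = cos_transform (swindow_spec sigma) t}.
Proof. by apply: ae_off_poles => t ta; rewrite cos_transform_swindow_spec. Qed.

Lemma window_ge0 t : 0 <= window sigma t.
Proof.
by rewrite divr_ge0 ?sqr_ge0//; move: (cos_geN1 (sigma * t)); lra.
Qed.

Lemma windowN t : window sigma (- t) = window sigma t.
Proof. by rewrite /window mulrN cosN sqrrN. Qed.

Lemma swindowN t : swindow sigma (- t) = swindow sigma t.
Proof. by rewrite /swindow windowN sqrrN. Qed.

Lemma measurable_window : measurable_fun setT (window sigma).
Proof.
apply: measurable_funM.
  by apply: measurable_funD => //; exact: measurable_cosM.
apply: (measurableT_comp (@measurable_inv R)).
by apply: measurable_funX; apply: measurable_funB => //; exact: measurable_funX.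
Qed.

Lemma measurable_swindow : measurable_fun setT (swindow sigma).
Proof.
apply: measurable_funM; last exact: measurable_window.
by apply: measurable_funB => //; exact: measurable_funX.
Qed.

Lemma window_pole t : t ^+ 2 = a ^+ 2 -> window sigma t = 0.
Proof. by move=> ta; rewrite /window -/a ta subrr expr0n invr0 mulr0. Qed.

Lemma swindow_pole t : t ^+ 2 = a ^+ 2 -> swindow sigma t = 0.
Proof. by move=> ta; rewrite /swindow -/a ta subrr mul0r. Qed.

Lemma window_bound t : `|window sigma t| <= \int[leb]_s `|window_spec sigma s|.
Proof.
have [/window_pole ->|ta] := eqVneq (t ^+ 2) (a ^+ 2).
  by rewrite normr0; exact: Rintegral_ge0.
by rewrite -cos_transform_window_spec// normr_cos_transform_le// integrable_window_spec.
Qed.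

Lemma swindow_bound t : `|swindow sigma t| <= \int[leb]_s `|swindow_spec sigma s|.
Proof.
have [/swindow_pole ->|ta] := eqVneq (t ^+ 2) (a ^+ 2).
  by rewrite normr0; exact: Rintegral_ge0.
by rewrite -cos_transform_swindow_spec// normr_cos_transform_le// integrable_swindow_spec.
Qed.

Lemma swindow_decay t : `|(t ^+ 2 - a ^+ 2) * swindow sigma t| <= 2.
Proof.
have [/swindow_pole ->|] := eqVneq (t ^+ 2) (a ^+ 2); first by rewrite mulr0 normr0.
rewrite -subr_eq0 => ta.
have -> : (t ^+ 2 - a ^+ 2) * swindow sigma t = 1 + cos (sigma * t).
  by rewrite /swindow /window -/a; field.
by rewrite ler_norml; move: (cos_geN1 (sigma * t)) (cos_le1 (sigma * t)); lra.
Qed.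

(** Writing [1 + t ^+ 2] as [(1 + a ^+ 2) + (t ^+ 2 - a ^+ 2)] reduces quadratic
    decay to boundedness of the function and of its product with
    [t ^+ 2 - a ^+ 2]. *)
Lemma integrable_swindow : leb.-integrable setT (EFin \o swindow sigma).
Proof.
set B := \int[leb]_s `|swindow_spec sigma s|.
apply: (@integrable_quadratic_decay R _ (B * (1 + a ^+ 2) + 2)).
  exact: measurable_swindow.
move=> t; have := swindow_bound t; rewrite -/B => hB; have := swindow_decay t.
have t2 : 1 + t ^+ 2 = (1 + a ^+ 2) + (t ^+ 2 - a ^+ 2) by ring.
rewrite t2 mulrDr normrM mulrC => hD; apply: lerD.
  by rewrite ler_wpM2r// addr_ge0// sqr_ge0.
by apply: le_trans hD; rewrite ler_wpM2l// ler_norm.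
Qed.

Lemma integrable_window : leb.-integrable setT (EFin \o window sigma).
Proof.
set B := \int[leb]_s `|window_spec sigma s|.
set B' := \int[leb]_s `|swindow_spec sigma s|.
apply: (@integrable_quadratic_decay R _ (B * (1 + a ^+ 2) + B')).
  exact: measurable_window.
move=> t; have := window_bound t; rewrite -/B => hB; have := swindow_bound t.
have t2 : 1 + t ^+ 2 = (1 + a ^+ 2) + (t ^+ 2 - a ^+ 2) by ring.
rewrite -/B' {1}/swindow -/a t2 mulrDr normrM mulrC => hD; apply: lerD.
  by rewrite ler_wpM2r// addr_ge0// sqr_ge0.
by apply: le_trans hD; rewrite ler_wpM2l// ler_norm.
Qed.

Lemma window_spec_bound s : `|window_spec sigma s| <= (2 * a ^+ 3)^-1 * (a * sigma + 1).
Proof.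
have a0 := freq_gt0.
have c0 : 0 <= (2 * a ^+ 3)^-1 by rewrite invr_ge0 mulr_ge0// exprn_ge0// ltW.
rewrite /window_spec patchE mem_setE in_itv/=; case: ifPn => [/andP[s0 s1]|_]; last first.
  by rewrite normr0 mulr_ge0// addr_ge0// mulr_ge0// ltW.
rewrite normrM -/a (ger0_norm c0) ler_wpM2l// (le_trans (ler_normD _ _))// lerD ?sin_max//.
rewrite normrM (gtr0_norm a0) ler_wpM2l ?(ltW a0)// normrM -[leRHS]mulr1.
by rewrite ler_pM ?cos_max// ger0_norm ?subr_ge0// lerBlDr lerDl.
Qed.

Lemma swindow_spec_bound s : `|swindow_spec sigma s| <= a^-1.
Proof.
have a0 := freq_gt0; have ai0 : 0 <= a^-1 by rewrite invr_ge0 ltW.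
rewrite /swindow_spec patchE mem_setE; case: ifPn => [_|_]; last by rewrite normr0.
by rewrite normrM normrN (ger0_norm ai0) ler_piMr// sin_max.
Qed.

Lemma swindow_spec_lip s : `|swindow_spec sigma s| <= `|s|.
Proof.
have a0 := freq_gt0; have ai0 : 0 <= a^-1 by rewrite invr_ge0 ltW.
rewrite /swindow_spec patchE mem_setE; case: ifPn => [_|_]; last by rewrite normr0.
rewrite normrM normrN (ger0_norm ai0) mulrC ler_pdivrMr//.
by rewrite (le_trans (normr_sin_le _))// normrM (gtr0_norm a0) mulrC.
Qed.

Lemma window_spec_supp s : ~ `[0, sigma]%classic s -> window_spec sigma s = 0.
Proof. by move=> ns; rewrite /window_spec patchE ifF//; apply/negP; rewrite inE. Qed.

Lemma swindow_spec_supp s : ~ `[0, sigma]%classic s -> swindow_spec sigma s = 0.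
Proof. by move=> ns; rewrite /swindow_spec patchE ifF//; apply/negP; rewrite inE. Qed.

Lemma cos_transform_window x : sigma < `|x| -> cos_transform (window sigma) x = 0.
Proof.
apply: (cos_transform_outside sigma0 integrable_window integrable_window_spec windowN ae_window_spec).
  exact: window_spec_bound.
exact: window_spec_supp.
Qed.

Lemma cos_transform_swindow x : sigma < `|x| -> cos_transform (swindow sigma) x = 0.
Proof.
apply: (cos_transform_outside sigma0 integrable_swindow integrable_swindow_spec swindowN ae_swindow_spec).
  exact: swindow_spec_bound.
exact: swindow_spec_supp.
Qed.

Lemma cos_transform_swindow0 : cos_transform (swindow sigma) 0 = 0.
Proof.
apply: (cos_transform_eq0 (M := 1) integrable_swindow integrable_swindow_spec swindowN ae_swindow_spec).
- by move=> s; rewrite subr0 mul1r swindow_spec_lip.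
- by move=> s; rewrite addr0 mul1r swindow_spec_lip.
- exact: swindow_spec_supp.
Qed.

Lemma cosM_ge0 t : 0 <= t <= a / 2 -> 0 <= cos (sigma * t).
Proof.
move=> /andP[t0 ta]; apply: cos_ge0_pihalf; apply/andP; split.
  by rewrite (@le_trans _ _ 0) ?mulr_ge0 ?(ltW sigma0)// oppr_le0 divr_ge0// pi_ge0.
by rewrite -freqM -/a (mulrC a) -mulrA ler_wpM2l// ltW.
Qed.

Lemma sqrB_freq_lt0 t : 0 <= t <= a / 2 -> t ^+ 2 - a ^+ 2 < 0.
Proof.
move=> /andP[t0 ta]; have a0 := freq_gt0.
by rewrite subr_lt0 ltr_sqr ?nnegrE ?(ltW a0)//; lra.
Qed.

Lemma window_ge t : 0 <= t <= a / 2 -> a ^- 4 <= window sigma t.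
Proof.
move=> ta; have a0 := freq_gt0; have cs := cosM_ge0 ta.
have ta2 := sqrB_freq_lt0 ta.
have p0 : 0 < (t ^+ 2 - a ^+ 2) ^+ 2 by rewrite exprn_even_gt0//= lt_eqF.
rewrite /window -/a (@le_trans _ _ (((t ^+ 2 - a ^+ 2) ^+ 2)^-1))//.
  rewrite lef_pV2 ?posrE ?p0 ?(exprn_gt0 4)// -sqrrN opprB.
  rewrite (_ : 4 = 2 * 2)%N// exprM ler_sqr ?nnegrE ?sqr_ge0//; last by lra.
  by rewrite lerBlDr lerDl sqr_ge0.
by rewrite ler_peMl ?invr_ge0 ?(ltW p0)// lerDl.
Qed.

Lemma swindow_sqr_ge t : 0 <= t <= a / 2 -> window sigma t <= swindow sigma t * swindow sigma t.
Proof.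
move=> ta; have /lt_eqF/negbT ta2 := sqrB_freq_lt0 ta.
have -> : swindow sigma t * swindow sigma t = (1 + cos (sigma * t)) * window sigma t.
  by rewrite /swindow /window -/a; field.
by rewrite ler_peMl ?window_ge0// lerDl cosM_ge0.
Qed.

Lemma cos_transform_window0_gt0 : 0 < cos_transform (window sigma) 0.
Proof.
have a0 := freq_gt0.
rewrite /cos_transform; under eq_Rintegral do rewrite mul0r cos0 mulr1.
apply: (@Rintegral_gt0 R _ (a / 2) (a ^- 4)).
- by rewrite divr_gt0.
- by rewrite invr_gt0 exprn_gt0.
- exact: integrable_window.
- exact: window_ge0.
- exact: window_ge.
Qed.

(** If the transform of [swindow sigma] vanished identically, the multiplication
    formula for [swindow sigma] and [swindow_spec sigma] would make the integral of
    [swindow sigma t * swindow sigma t] zero. *)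
Lemma cos_transform_swindow_neq0 : exists x, cos_transform (swindow sigma) x != 0.
Proof.
apply: contrapT => h0; have a0 := freq_gt0.
have {}h0 x : cos_transform (swindow sigma) x = 0.
  by apply/eqP; apply: contrapT => /negP hx; apply: h0; exists x.
have ih2 : leb.-integrable setT (EFin \o (fun t => swindow sigma t * swindow sigma t)).
  by apply: (integrable_mul_bounded integrable_swindow measurable_swindow swindow_bound).
have : 0 < \int[leb]_t (swindow sigma t * swindow sigma t).
  apply: (@Rintegral_gt0 R _ (a / 2) (a ^- 4)) => //.
  - by rewrite divr_gt0.
  - by rewrite invr_gt0 exprn_gt0.
  - by move=> t; rewrite -expr2 sqr_ge0.
  - by move=> t ta; rewrite (le_trans (window_ge ta))// swindow_sqr_ge.
have -> : \int[leb]_t (swindow sigma t * swindow sigma t) =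
    \int[leb]_t (swindow sigma t * cos_transform (swindow_spec sigma) t).
  congr fine; apply: ae_eq_integral => //.
  - by apply/measurable_EFinP; apply: measurable_funM; exact: measurable_swindow.
  - exact: measurable_int (integrable_mul_cos_transform integrable_swindow integrable_swindow_spec).
  - by apply: ae_off_poles => t ta _; rewrite cos_transform_swindow_spec.
rewrite (cos_transform_mult integrable_swindow integrable_swindow_spec).
under eq_Rintegral do rewrite h0 mulr0.
by rewrite Rintegral_cst// mul0r ltxx.
Qed.

End fixed_sigma.
End window.

(** * Tensor products on R^n *)

Section tensor.
Context {R : realType}.
Notation leb := (@lebesgue_measure R).

Definition tensor n (u : 'I_n -> R -> R) (v : 'rV[R]_n) : R :=
  \prod_(k < n) u k (v ord0 k).

Lemma measurable_tensor n (u : 'I_n -> R -> R) :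
  (forall k, measurable_fun setT (u k)) -> measurable_fun setT (tensor u).
Proof.
move=> mu_; apply: measurable_prod => k _.
exact: measurableT_comp (mu_ k) (measurable_fun_coord k).
Qed.

Lemma measurable_dotrV n (x : 'rV[R]_n) : measurable_fun setT (dotrV x).
Proof.
apply: measurable_sum => k; apply: measurable_funM => //.
exact: measurable_fun_coord.
Qed.

Lemma measurable_cos_dotrV n (x : 'rV[R]_n) :
  measurable_fun setT (fun v => cos (dotrV x v)).
Proof.
apply: (@measurableT_comp _ _ _ _ _ _ (@cos R)); last exact: measurable_dotrV.
by apply: continuous_measurable_fun; exact: continuous_cos.
Qed.

Lemma measurable_sin_dotrV n (x : 'rV[R]_n) :
  measurable_fun setT (fun v => sin (dotrV x v)).
Proof.
apply: (@measurableT_comp _ _ _ _ _ _ (@sin R)); last exact: measurable_dotrV.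
by apply: continuous_measurable_fun; exact: continuous_sin.
Qed.

Section lebesgue_rV_cons.
Variables (n : nat) (F : 'rV[R]_n.+1 -> R).
Hypothesis mF : measurable_fun setT F.
Hypothesis iF :
  (leb \x lebesgue_rV n)%E.-integrable setT (EFin \o (fun p => F (cons_rV p))).

Let iF' : (leb \x lebesgue_rV n)%E.-integrable (@cons_rV R n @^-1` setT)
  ((EFin \o F) \o @cons_rV R n).
Proof. by rewrite preimage_setT. Qed.

(* The same measurability as measurable_cons_rV, at the structure on R that
   carries lebesgue_measure. *)
Let mcons : measurable_fun [set: measurableTypeR R * 'rV[R]_n]
  (@cons_rV R n : measurableTypeR R * 'rV[R]_n -> 'rV[R]_n.+1).
Proof. exact: measurable_cons_rV. Qed.

(* lebesgue_rV n.+1 and this measure have the same underlying set function, but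
   they are different structures. *)
Let push : {measure set 'rV[R]_n.+1 -> \bar R} :=
  measure_function_pushforward__canonical__measure_function_Measure
    (leb \x lebesgue_rV n)%E mcons.

Let integral_push (G : 'rV[R]_n.+1 -> \bar R) :
  (\int[lebesgue_rV n.+1]_v G v = \int[push]_v G v)%E.
Proof. exact: eq_measure_integral. Qed.

Let mF' : measurable_fun setT (EFin \o F).
Proof. exact/measurable_EFinP. Qed.

Lemma integrable_lebesgue_rV_cons :
  (lebesgue_rV n.+1).-integrable setT (EFin \o F).
Proof.
have /integrableP[_ Foo] : push.-integrable setT (EFin \o F) :=
  integrable_pushforward mcons mF' iF' measurableT.
by apply/integrableP; split; rewrite ?integral_push.
Qed.

Lemma Rintegral_lebesgue_rV_cons :
  \int[lebesgue_rV n.+1]_v F v = \int[(leb \x lebesgue_rV n)%E]_p F (cons_rV p).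
Proof.
congr fine; rewrite integral_push.
have := integral_pushforward mcons mF' iF' measurableT.
by rewrite preimage_setT.
Qed.

End lebesgue_rV_cons.

Lemma tensor_cons n (u : 'I_n.+1 -> R -> R) p :
  tensor u (cons_rV p) = u ord0 p.1 * tensor (fun k => u (lift ord0 k)) p.2.
Proof.
rewrite /tensor big_ord_recl cons_rV0; congr (_ * _).
by apply: eq_bigr => k _; rewrite cons_rVS.
Qed.

Lemma dotrV_cons n (x : 'rV[R]_n.+1) p :
  dotrV x (cons_rV p) = x ord0 ord0 * p.1 + dotrV (uncons_rV x).2 p.2.
Proof.
rewrite /dotrV big_ord_recl cons_rV0; congr (_ + _).
by apply: eq_bigr => k _; rewrite cons_rVS mxE.
Qed.

Lemma integrable_tensor n (u : 'I_n -> R -> R) :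
  (forall k, leb.-integrable setT (EFin \o u k)) ->
  (lebesgue_rV n).-integrable setT (EFin \o tensor u).
Proof.
elim: n u => [u _|n ih u iu].
  rewrite (_ : tensor u = cst 1).
    exact: (@finite_measure_integrable_cst _ _ _ (\d_(0 : 'rV[R]_0))).
  by apply/funext => v; rewrite /tensor big_ord0.
apply: integrable_lebesgue_rV_cons.
  by apply: measurable_tensor => k; exact: (integrable_measurable (iu k)).
rewrite (_ : (fun p => _) =
    (fun p => u ord0 p.1 * tensor (fun k => u (lift ord0 k)) p.2)).
  by apply: integrable_prod => //; exact: ih.
by apply/funext => p; exact: tensor_cons.
Qed.

Section trig_transform.
Variables (n : nat) (u : 'I_n -> R -> R).
Hypothesis iu : forall k, leb.-integrable setT (EFin \o u k).

Lemma integrable_tensor_cos x :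
  (lebesgue_rV n).-integrable setT (EFin \o (fun v => tensor u v * cos (dotrV x v))).
Proof.
apply: (integrable_mul_bounded (M := 1)); first exact: integrable_tensor.
- exact: measurable_cos_dotrV.
- by move=> v; exact: cos_max.
Qed.

Lemma integrable_tensor_sin x :
  (lebesgue_rV n).-integrable setT (EFin \o (fun v => tensor u v * sin (dotrV x v))).
Proof.
apply: (integrable_mul_bounded (M := 1)); first exact: integrable_tensor.
- exact: measurable_sin_dotrV.
- by move=> v; exact: sin_max.
Qed.

End trig_transform.

(** Since every factor is even, all the products with a sine that the addition
    formulas produce integrate to zero; the cosine and the sine statement are
    needed together for the induction. *)
Lemma tensor_transform n (u : 'I_n -> R -> R) (x : 'rV[R]_n) :
  (forall k, leb.-integrable setT (EFin \o u k)) ->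
  (forall k t, u k (- t) = u k t) ->
  \int[lebesgue_rV n]_v (tensor u v * cos (dotrV x v)) =
    \prod_(k < n) cos_transform (u k) (x ord0 k) /\
  \int[lebesgue_rV n]_v (tensor u v * sin (dotrV x v)) = 0.
Proof.
elim: n u x => [u x _ _|n ih u x iu uN].
  rewrite big_ord0; split.
    under eq_Rintegral do rewrite /tensor /dotrV !big_ord0 cos0 mulr1.
    rewrite Rintegral_cst// mul1r -[X in fine X]/(\d_(0 : 'rV[R]_0) setT).
    by rewrite diracE mem_set.
  under eq_Rintegral do rewrite /tensor /dotrV !big_ord0 sin0 mulr0.
  by rewrite Rintegral_cst// mul0r.
have iu0 := iu ord0; have iuS k := iu (lift ord0 k).
have [] := ih (fun k => u (lift ord0 k)) (uncons_rV x).2 iuS (fun k => uN _).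
set x' := (uncons_rV x).2; set u' := fun k => u (lift ord0 k) => hc hs.
have ic0 := integrable_mul_cos (x ord0 ord0) iu0.
have is0 := integrable_mul_sin (x ord0 ord0) iu0.
have ic' := integrable_tensor_cos iuS x'.
have is' := integrable_tensor_sin iuS x'.
have s0 := sin_transform_even (x ord0 ord0) iu0 (uN ord0).
have mu_ k : measurable_fun setT (u k) := integrable_measurable (iu k).
pose C p := u ord0 p.1 * cos (x ord0 ord0 * p.1) * (tensor u' p.2 * cos (dotrV x' p.2)).
pose S p := u ord0 p.1 * sin (x ord0 ord0 * p.1) * (tensor u' p.2 * sin (dotrV x' p.2)).
pose C' p := u ord0 p.1 * cos (x ord0 ord0 * p.1) * (tensor u' p.2 * sin (dotrV x' p.2)).
pose S' p := u ord0 p.1 * sin (x ord0 ord0 * p.1) * (tensor u' p.2 * cos (dotrV x' p.2)).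
have iC : (leb \x lebesgue_rV n)%E.-integrable setT (EFin \o C) := integrable_prod ic0 ic'.
have iS : (leb \x lebesgue_rV n)%E.-integrable setT (EFin \o S) := integrable_prod is0 is'.
have iC' : (leb \x lebesgue_rV n)%E.-integrable setT (EFin \o C') := integrable_prod ic0 is'.
have iS' : (leb \x lebesgue_rV n)%E.-integrable setT (EFin \o S') := integrable_prod is0 ic'.
have cosE : (fun p => tensor u (cons_rV p) * cos (dotrV x (cons_rV p))) = (fun p => C p - S p).
  by apply/funext => p; rewrite tensor_cons dotrV_cons cosD /C /S; ring.
have sinE : (fun p => tensor u (cons_rV p) * sin (dotrV x (cons_rV p))) = (fun p => S' p + C' p).
  by apply/funext => p; rewrite tensor_cons dotrV_cons sinD /C' /S'; ring.
split.
- rewrite Rintegral_lebesgue_rV_cons.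
  + rewrite cosE RintegralB//.
    rewrite (Rintegral_prod ic0 ic') (Rintegral_prod is0 is') s0 mul0r subr0 hc.
    rewrite big_ord_recl; congr (_ * _).
    by apply: eq_bigr => k _; rewrite mxE.
  + by apply: measurable_funM; [exact: measurable_tensor|exact: measurable_cos_dotrV].
  + by rewrite cosE; exact: (integrableB _ iC iS).
- rewrite Rintegral_lebesgue_rV_cons.
  + rewrite sinE RintegralD//.
    by rewrite (Rintegral_prod ic0 is') (Rintegral_prod is0 ic') s0 mul0r hs mulr0 addr0.
  + by apply: measurable_funM; [exact: measurable_tensor|exact: measurable_sin_dotrV].
  + by rewrite sinE; exact: (integrableD _ iS' iC').
Qed.

End tensor.

(** * Measures with a density *)

Section density.
Context d (T : measurableType d) (R : realType).
Variable mu : {sigma_finite_measure set T -> \bar R}.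

(** The function [psi] is the Radon-Nikodym derivative of [P]. *)
Lemma Rintegral_density (P : probability T R) (psi : T -> R) (F : T -> R) M :
  mu.-integrable setT (EFin \o psi) ->
  (forall A, measurable A -> P A = (\int[mu]_(t in A) (psi t)%:E)%E) ->
  measurable_fun setT F -> (forall t, `|F t| <= M) ->
  \int[P]_t F t = \int[mu]_t (psi t * F t).
Proof.
move=> ipsi Ppsi mF FM.
have mpsi := integrable_measurable ipsi.
have dom : P `<< mu.
  apply/null_content_dominatesP => A mA A0; rewrite Ppsi//.
  by apply: null_set_integral => //; apply/measurable_EFinP; exact: measurable_funTS.
have iF : P.-integrable setT (EFin \o F).
  apply: measurable_bounded_integrable => //.
    exact: le_lt_trans (probability_le1 P measurableT) (ltry _).
  exists M; split; first exact: num_real.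
  by move=> x Mx t _; exact: le_trans (FM t) (ltW Mx).
congr fine; rewrite -(Radon_Nikodym_change_of_variables dom)//=.
apply: ae_eq_integral => //.
- apply: emeasurable_funM; first exact/measurable_EFinP.
  by apply: (measurable_int mu); exact: Radon_Nikodym_integrable.
- by apply/measurable_EFinP; exact: measurable_funM.
- rewrite (_ : (fun t => (psi t * F t)%:E) = (fun t => (F t)%:E * (psi t)%:E)%E); last first.
    by apply/funext => t; rewrite -EFinM mulrC.
  apply: ae_eqe_mul2l.
  rewrite Radon_NikodymE//=; case: cid => /= h [h1 h2 h3].
  apply: integral_ae_eq => //=; first exact/measurable_EFinP.
  by move=> E _ mE; rewrite -h3//= Ppsi.
Qed.

Definition density_measure (psi : T -> R) (A : set T) : \bar R :=
  (\int[mu]_(t in A) (psi t)%:E)%E.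

Section density_probability.
Variable psi : T -> R.
Hypotheses (ipsi : mu.-integrable setT (EFin \o psi)) (psi0 : forall t, 0 <= psi t)
  (psi1 : \int[mu]_t psi t = 1).

Let density0 : density_measure psi set0 = 0%E.
Proof. by rewrite /density_measure integral_set0. Qed.

Let density_ge0 A : (0 <= density_measure psi A)%E.
Proof. by apply: integral_ge0 => t _; rewrite lee_fin. Qed.

Let density_sigma_additive : semi_sigma_additive (density_measure psi).
Proof.
move=> /= A mA tA mUA; rewrite /density_measure integral_bigcup//=; last first.
  exact: (integrableS _ _ (@subsetT _ _) ipsi).
apply: is_cvg_ereal_nneg_natsum_cond => n _ _.
by apply: integral_ge0 => /= x _; rewrite lee_fin.
Qed.

HB.instance Definition _ := isMeasure.Build _ _ _ (density_measure psi)
  density0 density_ge0 density_sigma_additive.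

Let density_setT : density_measure psi setT = 1%E.
Proof.
by rewrite /density_measure -psi1 /Rintegral fineK//; exact: integrable_fin_num.
Qed.

HB.instance Definition _ := @Measure_isProbability.Build _ _ R
  (density_measure psi) density_setT.

Lemma density_probability : exists P : probability T R,
  forall A, measurable A -> P A = (\int[mu]_(t in A) (psi t)%:E)%E.
Proof. by exists (density_measure psi). Qed.

End density_probability.

End density.

Lemma char_fun_density (R : realType) n (mu : probability 'rV[R]_n R) phi x :
  (lebesgue_rV n).-integrable setT (EFin \o phi) -> has_density mu phi ->
  char_fun mu x =
  ((\int[lebesgue_rV n]_t (phi t * cos (dotrV x t))) +i*
   (- \int[lebesgue_rV n]_t (phi t * sin (dotrV x t))))%C.
Proof.
move=> iphi dphi; rewrite /char_fun /cintegral /expi /=.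
under eq_Rintegral do rewrite cosN.
under [X in (_ +i* X)%C]eq_Rintegral do rewrite sinN.
rewrite (Rintegral_density iphi dphi (measurable_cos_dotrV x) (M := 1)); last first.
  by move=> t; exact: cos_max.
rewrite (Rintegral_density (F := fun t => - sin (dotrV x t)) iphi dphi (M := 1)); last 2 first.
- by apply: measurable_funN; exact: measurable_sin_dotrV.
- by move=> t; rewrite normrN sin_max.
congr (_ +i* _)%C.
under eq_Rintegral do rewrite mulrN -mulN1r.
rewrite RintegralZl ?mulN1r//.
exact: integrable_mul_bounded iphi (measurable_sin_dotrV x) (fun t => sin_max _).
Qed.

(** * The perturbation *)

Section witness.
Context {R : realType}.
Notation leb := (@lebesgue_measure R).
Variables (n : nat) (sigma : R).
Hypothesis sigma0 : 0 < sigma.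
Let a := freq sigma.

Definition witness_factor (k j : 'I_n) : R -> R :=
  if j == k then swindow sigma else window sigma.

(** The expanded form, whose transform is computed term by term; the factored
    form [witnessE] shows the sign. *)
Definition witness (v : 'rV[R]_n) : R := \sum_(k < n) tensor (witness_factor k) v.

Lemma integrable_witness_factor k j : leb.-integrable setT (EFin \o witness_factor k j).
Proof.
by rewrite /witness_factor; case: eqP => _; [exact: integrable_swindow|exact: integrable_window].
Qed.

Lemma witness_factorN k j t : witness_factor k j (- t) = witness_factor k j t.
Proof. by rewrite /witness_factor; case: eqP => _; [exact: swindowN|exact: windowN]. Qed.

Lemma integrable_witness : (lebesgue_rV n).-integrable setT (EFin \o witness).
Proof.
apply: integrable_sum_fun => k; apply: integrable_tensor => j.
exact: integrable_witness_factor.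
Qed.

Lemma witnessE v : witness v =
  (\sum_(k < n) v ord0 k ^+ 2 - n%:R * a ^+ 2) * tensor (fun=> window sigma) v.
Proof.
have -> : n%:R * a ^+ 2 = \sum_(k < n) a ^+ 2.
  by rewrite sumr_const card_ord mulr_natl.
rewrite -sumrB mulr_suml; apply: eq_bigr => k _.
rewrite /tensor (bigD1 k)//= [in RHS](bigD1 k)//= mulrA /witness_factor eqxx; congr (_ * _).
by apply: eq_bigr => j /negbTE ->.
Qed.

Lemma witness_cos x : \int[lebesgue_rV n]_v (witness v * cos (dotrV x v)) =
  \sum_(k < n) \prod_(j < n) cos_transform (witness_factor k j) (x ord0 j).
Proof.
under eq_Rintegral do rewrite mulr_suml.
rewrite Rintegral_sum; last first.
  by move=> k; apply: integrable_tensor_cos => j; exact: integrable_witness_factor.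
apply: eq_bigr => k _.
by have [] := tensor_transform x (integrable_witness_factor k) (witness_factorN k).
Qed.

Lemma witness_sin x : \int[lebesgue_rV n]_v (witness v * sin (dotrV x v)) = 0.
Proof.
under eq_Rintegral do rewrite mulr_suml.
rewrite Rintegral_sum; last first.
  by move=> k; apply: integrable_tensor_sin => j; exact: integrable_witness_factor.
apply: big1 => k _.
by have [] := tensor_transform x (integrable_witness_factor k) (witness_factorN k).
Qed.

Lemma witness_cos_outside x : (~` cube sigma) x ->
  \int[lebesgue_rV n]_v (witness v * cos (dotrV x v)) = 0.
Proof.
move=> /existsNP[j /negP]; rewrite -ltNge => xj.
rewrite witness_cos; apply: big1 => k _; rewrite (bigD1 j)//= /witness_factor.
by case: eqP => _; rewrite ?cos_transform_swindow ?cos_transform_window// mul0r.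
Qed.

Lemma Rintegral_witness : \int[lebesgue_rV n]_v witness v = 0.
Proof.
transitivity (\int[lebesgue_rV n]_v (witness v * cos (dotrV 0 v))).
  apply: eq_Rintegral => v _; rewrite (_ : dotrV 0 v = 0) ?cos0 ?mulr1//.
  by apply: big1 => k _; rewrite mxE mul0r.
rewrite witness_cos; apply: big1 => k _; rewrite (bigD1 k)//= mxE /witness_factor eqxx.
by rewrite cos_transform_swindow0// mul0r.
Qed.

(** At frequencies supported by the first coordinate only the term with [h] in
    that coordinate survives, since the transform of [h] vanishes at 0. *)
Lemma witness_cos_neq0 : (0 < n)%N ->
  exists x, \int[lebesgue_rV n]_v (witness v * cos (dotrV x v)) != 0.
Proof.
move=> n0; have [y hy] := cos_transform_swindow_neq0 sigma0.
pose i0 : 'I_n := Ordinal n0.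
exists (\row_j (if j == i0 then y else 0)); rewrite witness_cos (bigD1 i0)//=.
rewrite [X in _ + X]big1 ?addr0; last first.
  move=> k ki0; rewrite (bigD1 k)//= mxE (negbTE ki0) /witness_factor eqxx.
  by rewrite cos_transform_swindow0// mul0r.
apply/prodf_neq0 => j _; rewrite mxE /witness_factor; case: (j == i0) => //.
by rewrite gt_eqF// cos_transform_window0_gt0.
Qed.

Lemma tensor_window_bounds : exists2 C, 0 <= C &
  forall v : 'rV[R]_n, 0 <= tensor (fun=> window sigma) v <= C.
Proof.
set M := \int[leb]_s `|window_spec sigma s|.
have M0 : 0 <= M by apply: Rintegral_ge0.
exists (\prod_(k < n) M); first by apply: prodr_ge0.
move=> v; rewrite prodr_ge0/=; last by move=> k _; exact: window_ge0.
apply: ler_prod => k _; rewrite window_ge0/= (le_trans (ler_norm _))//.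
exact: window_bound.
Qed.

End witness.

Lemma compact_euclidean_ball (R : realType) n (r : R) :
  compact [set v : 'rV[R]_n | \sum_(k < n) v ord0 k ^+ 2 <= r].
Proof.
have csq (s : seq 'I_n) : continuous (fun v : 'rV[R]_n => \sum_(k <- s) v ord0 k ^+ 2).
  elim: s => [|k s ih].
    rewrite (_ : (fun v => _) = cst 0); first exact: cst_continuous.
    by apply/funext => v; rewrite big_nil.
  rewrite (_ : (fun v => _) =
      (fun v : 'rV[R]_n => v ord0 k * v ord0 k + \sum_(j <- s) v ord0 j ^+ 2)); last first.
    by apply/funext => v; rewrite big_cons expr2.
  have ck : continuous (fun v : 'rV[R]_n => v ord0 k) by exact: coord_continuous.
  move=> v; exact: (cvgD (cvgM (ck v) (ck v)) (ih v)).
(* The side r + 1 of the box comes from |z| <= z ^ 2 + 1. *)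
have cbox : compact
    [set v : 'rV[R]_n | forall k, v ord0 k \in `[(- (r + 1)), (r + 1)]].
  apply: (@rV_compact _ _ (fun=> `[(- (r + 1)), (r + 1)]%classic)).
  by move=> _; exact: segment_compact.
apply: subclosed_compact cbox _; last first.
  move=> v /= vr k; rewrite in_itv/= -ler_norml.
  have vk : v ord0 k ^+ 2 <= r.
    by apply: le_trans vr; rewrite (bigD1 k)//= lerDl sumr_ge0// => j _; rewrite sqr_ge0.
  have := sqr_ge0 (`|v ord0 k| - 1); rewrite sqrrB1 real_normK ?num_real// => h.
  have := normr_ge0 (v ord0 k); lra.
apply: (@preimage_closed _ _ (fun v : 'rV[R]_n => \sum_(k < n) v ord0 k ^+ 2) [set z | z <= r]).
  by move=> v _; exact: csq.
exact: closed_le.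
Qed.

Section perturbation.
Variables (R : realType) (n : nat) (sigma : R) (phi : 'rV[R]_n -> R).
Hypotheses (sigma0 : 0 < sigma) (cphi : continuous phi) (phi0 : forall t, 0 <= phi t).
Hypothesis phi_pos : forall t : 'rV[R]_n,
  \sum_(k < n) t ord0 k ^+ 2 <= n%:R * freq sigma ^+ 2 -> 0 < phi t.

(** Off the ball where [phi] is assumed positive both summands are nonnegative;
    on it [phi] is bounded below by compactness and the witness is bounded. *)
Lemma perturbation_ge0 : exists2 eps, 0 < eps &
  forall t, 0 <= phi t + eps * witness sigma t.
Proof.
set r := n%:R * freq sigma ^+ 2.
have r0 : 0 <= r by rewrite mulr_ge0 ?sqr_ge0.
pose K := [set v : 'rV[R]_n | \sum_(k < n) v ord0 k ^+ 2 <= r].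
have K0 : K !=set0.
  by exists 0; rewrite /K/= big1// => k _; rewrite mxE expr0n.
have [c Kc cmin] := compact_EVT_min K0 (@compact_euclidean_ball R n r)
  (continuous_subspaceT cphi).
have c0 : 0 < phi c by apply: phi_pos; move: Kc; rewrite inE.
have [C C0 wC] := @tensor_window_bounds R n sigma sigma0.
have D0 : 0 < r * C + 1 by rewrite ltr_wpDl// mulr_ge0.
(* The witness is at least - r * C on the ball; r * C may be zero. *)
exists (phi c / (r * C + 1)); first by rewrite divr_gt0.
move=> t; have /andP[w0 w1] := wC t; rewrite witnessE -/r.
have [tK|/ltW tK] := leP (\sum_(k < n) t ord0 k ^+ 2) r; last first.
  by rewrite addr_ge0// mulr_ge0 ?divr_ge0 ?(ltW c0) ?(ltW D0)// mulr_ge0// subr_ge0.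
have pc : phi c <= phi t by apply: cmin; rewrite inE.
have S0 : 0 <= \sum_(k < n) t ord0 k ^+ 2 by apply: sumr_ge0 => k _; rewrite sqr_ge0.
move: S0 tK pc; set S := \sum_(k < n) _; set w := tensor _ t in w0 w1 *; set e := _ / _.
move=> S0 tK pc.
have e0 : 0 <= e by rewrite divr_ge0 ?ltW.
have h1 : - (r * C) <= (S - r) * w.
  rewrite lerNl -mulNr opprB ler_pM// ?subr_ge0//.
  by rewrite lerBlDr lerDl.
have h2 : e * (r * C) <= phi c.
  by rewrite /e mulrAC ler_pdivrMr// ler_wpM2l ?(ltW c0)// lerDl.
by have := ler_wpM2l e0 h1; rewrite mulrN; lra.
Qed.

End perturbation.

Theorem theorem1p3 (R : realType) (n : nat) (hn : (1 <= n)%N)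
    (sigma : R) (hsigma : 0 < sigma)
    (phi : 'rV[R]_n -> R) (hphi : probability_density phi)
    (cphi : continuous phi)
    (f : 'rV[R]_n -> R[i]) (hf : is_char_fun_of_density phi f)
    (delta : R) (hdelta : 0 < delta)
    (hsupp : [set t : 'rV[R]_n | 0 < `|phi t|] =
             [set x : 'rV[R]_n | \sum_(k < n) `|x ord0 k| ^+ 2 < delta ^+ 2])
    (hds : pi * Num.sqrt n%:R < delta * sigma) :
  ~ deterministic sigma f.
Proof.
have [iphi phi0 _] := hphi; have [mu dmu ->] := hf.
have phi_pos (t : 'rV[R]_n) :
    \sum_(k < n) t ord0 k ^+ 2 <= n%:R * freq sigma ^+ 2 -> 0 < phi t.
  move=> tle; suff : [set t : 'rV[R]_n | 0 < `|phi t|] t by rewrite /= ger0_norm.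
  rewrite hsupp /=; under eq_bigr do rewrite real_normK ?num_real//.
  apply: (le_lt_trans tle).
  have -> : n%:R * freq sigma ^+ 2 = (pi * Num.sqrt n%:R / sigma) ^+ 2.
    by rewrite /freq !expr_div_n exprMn sqr_sqrtr ?ler0n// mulrA (mulrC n%:R).
  rewrite ltr_sqr ?nnegrE ?(ltW hdelta) ?divr_ge0 ?mulr_ge0 ?pi_ge0 ?sqrtr_ge0 ?(ltW hsigma)//.
  by rewrite ltr_pdivrMr.
have [eps eps0 psi0] := perturbation_ge0 hsigma cphi phi0 phi_pos.
have iw := integrable_witness n hsigma.
pose psi t := phi t + eps * witness sigma t.
have iew : (lebesgue_rV n).-integrable setT (EFin \o (fun t => eps * witness sigma t)).
  rewrite (_ : _ \o _ = (fun t => eps%:E * (witness sigma t)%:E)%E).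
    exact: integrableZl.
  by apply/funext => t /=; rewrite EFinM.
have ipsi : (lebesgue_rV n).-integrable setT (EFin \o psi).
  rewrite (_ : EFin \o psi = (EFin \o phi) \+ (EFin \o (fun t => eps * witness sigma t))).
    exact: integrableD.
  by apply/funext => t.
have psi1 : \int[lebesgue_rV n]_t psi t = 1.
  rewrite RintegralD// RintegralZl// Rintegral_witness// mulr0 addr0.
  by rewrite /Rintegral -dmu// probability_setT.
have [P dP] := density_probability ipsi psi0 psi1.
have int_trig (F : 'rV[R]_n -> R) : measurable_fun setT F -> (forall t, `|F t| <= 1) ->
    \int[lebesgue_rV n]_t (psi t * F t) =
    \int[lebesgue_rV n]_t (phi t * F t) +
    eps * \int[lebesgue_rV n]_t (witness sigma t * F t).
  move=> mF F1; rewrite -RintegralZl//; last exact: integrable_mul_bounded iw mF F1.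
  rewrite -RintegralD//; last 2 first.
  - exact: integrable_mul_bounded iphi mF F1.
  - rewrite (_ : (fun t => _) = (fun t => eps * witness sigma t * F t)).
      exact: integrable_mul_bounded iew mF F1.
    by apply/funext => t; rewrite mulrA.
  by apply: eq_Rintegral => t _; rewrite /psi mulrDl mulrA.
have charP x : char_fun P x = char_fun mu x +
    (eps * \int[lebesgue_rV n]_t (witness sigma t * cos (dotrV x t)))%:C%C.
  rewrite (char_fun_density _ iphi dmu) (char_fun_density _ ipsi dP).
  rewrite (int_trig _ (measurable_cos_dotrV x) (fun t => cos_max _)).
  rewrite (int_trig _ (measurable_sin_dotrV x) (fun t => sin_max _)).
  rewrite witness_sin// mulr0 addr0.
  by apply/eqP; rewrite eq_complex /= addr0 !eqxx.
apply; exists (char_fun P); split.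
- by exists P.
- have [x xn0] := witness_cos_neq0 hsigma hn.
  move=> /(congr1 (fun g => g x)); rewrite charP => /eqP.
  rewrite -subr_eq0 addrAC subrr add0r eq_complex /= eqxx andbT.
  by rewrite mulf_eq0 gt_eqF//= (negbTE xn0).
- move=> x xout; rewrite charP witness_cos_outside// mulr0.
  by rewrite addr0.
Qed.
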